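(* Let $d\ge2$, let $n\ge1$, and let $A$ be a compact semi-algebraic subset of $(\mathbb{S}^d)^n$ (identified with a subset of $\mathbb{R}^{(d+1)n}$). Then there exist a linkage $\mathcal{L}$ in $\mathbb{S}^d$ and a set $W$ of $n$ vertices of $\mathcal{L}$ such that $\mathrm{Conf}_{\mathbb{S}^d}^W(\mathcal{L})=A$ (identifying $(\mathbb{S}^d)^W$ with $(\mathbb{S}^d)^n$ by an ordering of $W$).
   Context: $\mathbb{S}^d$ is the unit sphere of $\mathbb{R}^{d+1}$ with its standard Riemannian (geodesic) distance $\delta$, i.e. $\delta(\alpha,\beta)=\arccos\langle\alpha,\beta\rangle\in[0,\pi]$. A linkage $\mathcal{L}$ in $\mathbb{S}^d$ is a finite connected graph $(V,E)$ together with a length function $l:E\to\mathbb{R}_{\ge0}$, a non-empty set $F\subseteq V$ of fixed vertices and a map $\phi_0:F\to\mathbb{S}^d$. A realization of $\mathcal{L}$ is a map $\phi:V\to\mathbb{S}^d$ with $\phi|_F=\phi_0$ and $\delta(\phi(v_1),\phi(v_2))=l(v_1v_2)$ for every edge $v_1v_2\in E$. For $W\subseteq V$, the partial configuration space is $\mathrm{Conf}_{\mathbb{S}^d}^W(\mathcal{L})=\{\phi|_W : \phi \text{ realization of } \mathcal{L}\}\subseteq(\mathbb{S}^d)^W$. An algebraic subset of $\mathbb{R}^k$ is a set $f^{-1}(0)$ with $f:\mathbb{R}^k\to\mathbb{R}^m$ polynomial. A semi-algebraic subset of $\mathbb{R}^k$ is the image of an algebraic subset of some $\mathbb{R}^N$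 ($N\ge k$) under the projection to the first $k$ coordinates. A semi-algebraic subset of $(\mathbb{S}^d)^n$ is a semi-algebraic subset of $\mathbb{R}^{(d+1)n}$ contained in $(\mathbb{S}^d)^n$. *)

(* Defs.v *)
From HB Require Import structures.
From mathcomp Require Import all_boot all_order all_algebra.
From mathcomp Require Import all_classical all_reals all_analysis.
(* The notations of [mpoly] clash with those of MathComp-Analysis. *)
From mathcomp Require Import -(notations) mpoly.

Set Implicit Arguments.
Unset Strict Implicit.
Unset Printing Implicit Defensive.

Import Order.TTheory GRing.Theory Num.Theory.
Import numFieldNormedType.Exports.

Local Open Scope classical_set_scope.
Local Open Scope ring_scope.

Section Sphere.
Context {R : realType} {d : nat}.

Definition dotprod (x y : 'rV[R]_d.+1) : R := \sum_j x 0 j * y 0 j.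

Definition sphere : set 'rV[R]_d.+1 := [set x | dotprod x x = 1].

(* By Cauchy-Schwarz, [acos] is applied to a point of [-1, 1] when [x] and [y]
   are on the sphere. *)
Definition geodist (x y : 'rV[R]_d.+1) : R := acos (dotprod x y).

(* A point of (R^(d+1))^n is a matrix whose i-th row is its i-th component. *)
Definition sphere_pow (n : nat) : set 'M[R]_(n, d.+1) :=
  [set X | forall i, sphere (row i X)].

End Sphere.

Section SemiAlgebraic.
Context {R : realType}.

Definition algebraic (k : nat) (A : set 'rV[R]_k) : Prop :=
  exists (m : nat) (f : 'I_m -> mpoly k R),
    A = [set x : 'rV[R]_k | forall i, meval (x 0) (f i) = 0].

(* [lsubmx] is the projection of R^(k + r) onto the first [k] coordinates. *)
Definition semialgebraic (k : nat) (A : set 'rV[R]_k) : Prop :=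
  exists (r : nat) (B : set 'rV[R]_(k + r)),
    algebraic B /\ A = lsubmx @` B.

(* [mxvec] identifies (R^(d+1))^n with R^(n * (d+1)). *)
Definition semialgebraic_sphere_pow (n d : nat) (A : set 'M[R]_(n, d.+1)) :
    Prop :=
  A `<=` @sphere_pow R d n /\ semialgebraic (mxvec @` A).

End SemiAlgebraic.

(* Edges are two-element sets of vertices.  The functions [len] and [fixed_pos]
   are total; only their values on [edges] and on [fixed] are used. *)
Record linkage (R : realType) (d : nat) := Linkage {
  vertex : finType;
  edges : {set {set vertex}};
  card_edge : forall e, e \in edges -> #|e| = 2%N;
  edges_connected : forall v w,
    connect [rel x y | [set x; y]%SET \in edges] v w;
  len : {set vertex} -> R;
  len_ge0 : forall e, e \in edges -> 0 <= len e;
  fixed : {set vertex};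
  fixed_neq0 : fixed != finset.set0;
  fixed_pos : vertex -> 'rV[R]_d.+1;
  fixed_pos_sphere : forall v, v \in fixed -> sphere (fixed_pos v)
}.

Arguments len {R d} l _.
Arguments fixed_pos {R d} l _.

Section Configurations.
Context {R : realType} {d : nat} (L : linkage R d).

Definition realization : set (vertex L -> 'rV[R]_d.+1) :=
  [set phi | [/\ forall v, sphere (phi v),
                 forall v, v \in fixed L -> phi v = fixed_pos L v &
                 forall v w, [set v; w]%SET \in edges L ->
                   geodist (phi v) (phi w) = len L [set v; w]%SET]].

Definition conf (W : {set vertex L}) :
    set ({v : vertex L | v \in W} -> 'rV[R]_d.+1) :=
  [set (fun v => phi (val v)) | phi in realization].

End Configurations.

Arguments realization {R d} L _.
Arguments conf {R d} L W _.

(* Main.v *)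
Require Import Defs.
From HB Require Import structures.
From mathcomp Require Import all_boot all_order all_algebra.
From mathcomp Require Import all_classical all_reals all_analysis.
From mathcomp Require mpoly.
From mathcomp Require ordered_qelim qe_rcf.
From mathcomp Require Import ring lra.
Set Implicit Arguments.
Unset Strict Implicit.
Unset Printing Implicit Defensive.
Import Order.TTheory GRing.Theory Num.Theory.
Import numFieldNormedType.Exports.
Local Open Scope classical_set_scope.
Local Open Scope ring_scope.

(** The edges of a linkage impose equations <x, y> = c between its vertices,
    and passing to the vertices of W is an existential quantification over the
    other ones.  So the sets Conf^W are the sets that can be defined by
    existentially quantified conjunctions of equations <x, y> = c with
    -1 <= c <= 1, where x and y are variables or constants of the sphere:
    [definable] is this notion and [definable_linkage] builds the linkage.
    What has to be shown is that every compact semialgebraic set A is definable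
    in this sense.  An algebraic and a geometric half are needed.

    Algebra.  A quantified point lives in a compact space, whereas the
    definition of a semialgebraic set as a projection of an algebraic set
    quantifies over unbounded reals.  The first half writes A as the set of
    those x for which equations F_k (x, u) = 0 have a solution u with
    coordinates in [-C, C] ([compact_semialgebraic_bounded_equations]).
    By quantifier elimination, membership in A depends on the signs of finitely
    many polynomials p_i.  A sign cell disjoint from A has the form
    { f = 0, all g_i > 0 } with f >= 0, and if g is the product of the g_i,
    then g vanishes at the zeros of f in the compact set
    { x in A | all g_i >= 0 }.  A Lojasiewicz inequality g ^ N <= K f on this
    set ([lojasiewicz]) shows that A is contained in the closed set
    { some g_i <= 0, or g ^ N <= K f }, which misses the cell.  A is the
    intersection of these closed sets, and a disjunction of inequalities
    h_i <= 0 is the solvability of the equation \prod_i (h_i + u_i ^ 2) = 0,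
    with bounded u_i as A is compact.
      The Lojasiewicz inequality is proved in the plane: the pairs
    (g x, f x) form a semialgebraic set, again described by the signs of
    finitely many polynomials Q_i (s, w).  The least value w of f on the level
    set g = s is a point where some sign changes, so a root of some nonzero
    polynomial Q_i (s, -), and a nonzero root of a polynomial is bounded below
    by a multiple of its lowest nonzero coefficient, which here is a nonzero
    polynomial in s and decreases at most like a power of s.

    Geometry.  Besides equality and orthogonality, the only relation used is
    <x, y> >= 0, which says that x and y have a common neighbour at distance pi / 4.
    A real number a is encoded by the unit vector along e_0 + a e_1; the bound
    |a| <= C is expressed with two half-spaces.  Inside the span of three basis
    vectors, being orthogonal to v and to w means being parallel to their cross
    product, as soon as this cross product is nonzero.  Chains of cross
    products, none of which vanishes for any value of the numbers, lead
    from e_0 + a e_1 and e_0 + b e_1 to e_0 + (a - b) e_1 and to e_0 + ab e_1.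
    So polynomial equations between encoded numbers are definable
    ([polyfun_zero_definable]).  At last, that the numbers t_j are the
    coordinates of a point x is expressed by saying that t has norm 1, is
    proportional to x and has coordinates with the same signs as those of x
    ([definable_coordinates]). *)

(** * Polynomial functions *)

Definition joint (T I J : Type) (x : I -> T) (y : J -> T) (k : I + J) : T :=
  match k with inl i => x i | inr j => y j end.

Section PolyFun.
Variable R : realType.

(** An inductive class of functions rather than a type of polynomials: variables
    may be indexed by any type, and no evaluation has to be unfolded when
    polynomials are substituted in each other. *)
Inductive polyfun (I : Type) : ((I -> R) -> R) -> Prop :=
| polyfun_cst c : polyfun (fun=> c)
| polyfun_var i : polyfun (fun x => x i)
| polyfun_add f g : polyfun f -> polyfun g -> polyfun (fun x => f x + g x)
| polyfun_mul f g : polyfun f -> polyfun g -> polyfun (fun x => f x * g x).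

Lemma polyfun_ext I (f g : (I -> R) -> R) : f =1 g -> polyfun g -> polyfun f.
Proof. by move=> /funext ->. Qed.

Lemma polyfun_opp I (f : (I -> R) -> R) :
  polyfun f -> polyfun (fun x => - f x).
Proof.
move=> pf; apply: (@polyfun_ext _ _ (fun x => -1 * f x)).
  by move=> x; rewrite mulN1r.
exact/polyfun_mul/pf/polyfun_cst.
Qed.

Lemma polyfun_exp I (f : (I -> R) -> R) n :
  polyfun f -> polyfun (fun x => f x ^+ n).
Proof.
move=> pf; elim: n => [|n IHn]; first exact: polyfun_cst.
by apply: polyfun_ext (polyfun_mul pf IHn) => x; rewrite exprS.
Qed.

Lemma polyfun_sum I (T : Type) (s : seq T) (P : pred T)
    (f : T -> (I -> R) -> R) :
  (forall t, P t -> polyfun (f t)) -> polyfun (fun x => \sum_(t <- s | P t) f t x).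
Proof.
move=> pf; elim: s => [|t s IHs].
  by apply: polyfun_ext (polyfun_cst _ 0) => x; rewrite big_nil.
case Pt: (P t); last by apply: polyfun_ext IHs => x; rewrite big_cons Pt.
by apply: polyfun_ext (polyfun_add (pf _ Pt) IHs) => x; rewrite big_cons Pt.
Qed.

Lemma polyfun_prod I (T : Type) (s : seq T) (P : pred T)
    (f : T -> (I -> R) -> R) :
  (forall t, P t -> polyfun (f t)) -> polyfun (fun x => \prod_(t <- s | P t) f t x).
Proof.
move=> pf; elim: s => [|t s IHs].
  by apply: polyfun_ext (polyfun_cst _ 1) => x; rewrite big_nil.
case Pt: (P t); last by apply: polyfun_ext IHs => x; rewrite big_cons Pt.
by apply: polyfun_ext (polyfun_mul (pf _ Pt) IHs) => x; rewrite big_cons Pt.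
Qed.

Lemma polyfun_comp I J (f : (I -> R) -> R) (g : I -> (J -> R) -> R) :
  polyfun f -> (forall i, polyfun (g i)) -> polyfun (fun x => f (g^~ x)).
Proof.
move=> pf pg; elim: pf => {f} [c|i|f1 f2 _ IH1 _ IH2|f1 f2 _ IH1 _ IH2].
- exact: polyfun_cst.
- exact: pg.
- exact: polyfun_add.
- exact: polyfun_mul.
Qed.

Lemma polyfun_reindex I J (h : I -> J) (f : (I -> R) -> R) :
  polyfun f -> polyfun (fun x => f (x \o h)).
Proof.
by move=> pf; apply: (polyfun_comp pf) => i; exact: (@polyfun_var J (h i)).
Qed.

Lemma polyfun_bounded I (f : (I -> R) -> R) (b : R) :
  polyfun f -> exists2 M, 0 <= M &
    forall x, (forall i, `|x i| <= b) -> `|f x| <= M.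
Proof.
elim=> {f} [c|i|f g _ [M M0 fM] _ [N N0 gN]|f g _ [M M0 fM] _ [N N0 gN]].
- by exists `|c|.
- exists `|b| => // x xb; exact: le_trans (xb i) (ler_norm _).
- exists (M + N) => [|x xb]; first exact: addr_ge0.
  by rewrite (le_trans (ler_normD _ _))// lerD ?fM ?gN.
- exists (M * N) => [|x xb]; first exact: mulr_ge0.
  by rewrite normrM ler_pM ?fM ?gN.
Qed.

Lemma polyfun_continuous I (T : topologicalType) (co : T -> I -> R)
    (f : (I -> R) -> R) :
  (forall i, continuous (co^~ i)) -> polyfun f -> continuous (f \o co).
Proof.
move=> cco; elim=> {f} [c|i|f g _ cf _ cg|f g _ cf _ cg] x.
- exact: cvg_cst.
- exact: cco.
- by apply: cvgD; [exact: cf|exact: cg].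
- by apply: cvgM; [exact: cf|exact: cg].
Qed.

Lemma polyfun_meval k (p : mpoly.mpoly k R) :
  polyfun (fun x : 'I_k -> R => mpoly.meval x p).
Proof.
apply: polyfun_ext (fun x => mpoly.mevalE x p) _.
apply: polyfun_sum => m _; apply: polyfun_mul; first exact: polyfun_cst.
apply: polyfun_prod => i _; apply: polyfun_exp; exact: polyfun_var.
Qed.

Lemma polyfun2_horner (f : (bool -> R) -> R) :
  polyfun f -> exists P : {poly {poly R}},
    forall x, f x = P.[(x true)%:P].[x false].
Proof.
elim=> {f} [c|[]|f g _ [P fP] _ [Q gQ]|f g _ [P fP] _ [Q gQ]].
- by exists c%:P%:P => x; rewrite !hornerC.
- by exists 'X => x; rewrite hornerX hornerC.
- by exists 'X%:P => x; rewrite hornerC hornerX.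
- by exists (P + Q) => x; rewrite fP gQ !hornerE.
- by exists (P * Q) => x; rewrite fP gQ !hornerE.
Qed.

End PolyFun.

(** * Quantifier elimination *)

Section QuantifierElimination.
Variable R : realType.
Import ordered_qelim.ord.

Definition env (I : finType) (x : I -> R) : seq R := [seq x i | i <- enum I].

Lemma nth_env (I : finType) (x : I -> R) i : (env x)`_(enum_rank i) = x i.
Proof. by rewrite (nth_map i) ?nth_enum_rank// -cardE ltn_ord. Qed.

Lemma polyfun_term (I : Type) (f : (I -> R) -> R) (h : I -> nat) :
  polyfun f -> exists2 t : GRing.term R, GRing.rterm t &
    forall e, GRing.eval e t = f (fun i => e`_(h i)).
Proof.
elim=> {f} [c|i|f g _ [t rt tE] _ [u ru uE]|f g _ [t rt tE] _ [u ru uE]].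
- by exists (GRing.Const c).
- by exists (GRing.Var _ (h i)).
- by exists (GRing.Add t u) => [|e] /=; rewrite ?rt ?ru// tE uE.
- by exists (GRing.Mul t u) => [|e] /=; rewrite ?rt ?ru// tE uE.
Qed.

Lemma term_polyfun (I : finType) (t : GRing.term R) :
  GRing.rterm t -> polyfun (fun x : I -> R => GRing.eval (env x) t).
Proof.
elim: t => //=.
- move=> n _; have [nI|In] := ltnP n #|I|.
    apply: polyfun_ext (polyfun_var R (enum_val (Ordinal nI))) => x.
    by rewrite -nth_env enum_valK.
  apply: polyfun_ext (polyfun_cst _ 0) => x.
  by rewrite nth_default// size_map -cardE.
- by move=> c _; exact: polyfun_cst.
- by move=> n _; exact: polyfun_cst.
- by move=> t IHt u IHu /andP[/IHt ? /IHu ?]; exact: polyfun_add.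
- by move=> t IHt /IHt ?; exact: polyfun_opp.
- move=> t IHt n /IHt pt; apply: polyfun_ext (polyfun_mul (polyfun_cst _ n%:R) pt).
  by move=> x; rewrite mulr_natl.
- by move=> t IHt u IHu /andP[/IHt ? /IHu ?]; exact: polyfun_mul.
- by move=> t IHt n /IHt ?; exact: polyfun_exp.
Qed.

(** The sets described by a quantifier-free formula, without mention of a
    formula: the sign vector of finitely many polynomials decides membership. *)
Definition sign_determined (I : Type) (A : (I -> R) -> Prop) :=
  exists (m : finType) (p : m -> (I -> R) -> R), (forall i, polyfun (p i)) /\
    forall x y, (forall i, Num.sg (p i x) = Num.sg (p i y)) -> A x -> A y.

Lemma sign_determined_bin I (A B C : (I -> R) -> Prop) :
  (forall x y, (A x -> A y) -> (A y -> A x) -> (B x -> B y) -> (B y -> B x) ->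
     C x -> C y) ->
  sign_determined A -> sign_determined B -> sign_determined C.
Proof.
move=> ABC [m [p [pp pA]]] [n [q [qp qB]]].
exists (m + n)%type, (fun k => match k with inl i => p i | inr i => q i end).
split=> [[]//|x y xy].
have pxy i : Num.sg (p i x) = Num.sg (p i y) := xy (inl i).
have qxy i : Num.sg (q i x) = Num.sg (q i y) := xy (inr i).
have [pyx qyx] := (fun i => esym (pxy i), fun i => esym (qxy i)).
by apply: ABC; [exact: pA|exact: pA|exact: qB|exact: qB].
Qed.

Lemma sign_determined_qf (I : finType) (f : formula R) :
  qf_form f -> rformula f ->
  sign_determined (fun x : I -> R => qf_eval (env x) f).
Proof.
have cst (b : Prop) : sign_determined (fun _ : I -> R => b).
  by exists void, (fun _ _ => 0); split=> [[]|].
(* an atom compares t and u, so it depends on the sign of t - u *)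
have atom t u (P : R -> bool) (A : (I -> R) -> bool) :
    (forall a b, Num.sg a = Num.sg b -> P a = P b) ->
    (forall x, A x = P (GRing.eval (env x) t - GRing.eval (env x) u)) ->
    GRing.rterm t -> GRing.rterm u -> sign_determined A.
  move=> Psg AP rt ru.
  exists unit, (fun=> fun x => GRing.eval (env x) t - GRing.eval (env x) u).
  split=> [_|x y /(_ tt) /Psg]; last by rewrite !AP => ->.
  by apply: polyfun_add; [exact: term_polyfun|exact/polyfun_opp/term_polyfun].
elim: f => //=.
- move=> t u _ /andP[rt ru]; apply: (atom t u (fun a => a == 0)) => // [a b ab|x].
    by rewrite -sgr_eq0 ab sgr_eq0.
  by rewrite subr_eq0.
- move=> t u _ /andP[rt ru]; apply: (atom t u (fun a => a < 0)) => // [a b ab|x].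
    by rewrite -sgr_lt0 ab sgr_lt0.
  by rewrite subr_lt0.
- move=> t u _ /andP[rt ru]; apply: (atom t u (fun a => a <= 0)) => // [a b ab|x].
    by rewrite -sgr_le0 ab sgr_le0.
  by rewrite subr_le0.
- move=> f IHf g IHg /andP[qf qg] /andP[rf rg].
  by apply: sign_determined_bin (IHf qf rf) (IHg qg rg) => x y; do 4![case: qf_eval] => //=; tauto.
- move=> f IHf g IHg /andP[qf qg] /andP[rf rg].
  by apply: sign_determined_bin (IHf qf rf) (IHg qg rg) => x y; do 4![case: qf_eval] => //=; tauto.
- move=> f IHf g IHg /andP[qf qg] /andP[rf rg].
  by apply: sign_determined_bin (IHf qf rf) (IHg qg rg) => x y; do 4![case: qf_eval] => //=; tauto.
- move=> f IHf qf rf.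
  by apply: sign_determined_bin (IHf qf rf) (IHf qf rf) => x y; do 2![case: qf_eval] => //=; tauto.
Qed.

(** The block of quantifiers binds the variables that follow those of the
    environment, so its witnesses are appended to the environment. *)
Lemma holds_exists_block (e : seq R) (f : formula R) m r : size e = m ->
  holds e (foldr (fun n g => Exists n g) f (iota m r)) <->
  exists2 s, size s = r & holds (e ++ s) f.
Proof.
elim: r e m => [|r IHr] e m em /=.
  split=> [ef|[s /size0nil ->]]; last by rewrite cats0.
  by exists [::]; rewrite // cats0.
have eE x : set_nth 0 e m x = rcons e x by rewrite -em; elim: (e) => //= a l ->.
split=> [[x]|[[|x s]//= [sr] esf]].
  rewrite eE IHr ?size_rcons ?em// => -[s sr]; rewrite cat_rcons => esf.
  by exists (x :: s) => //=; rewrite sr.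
exists x; rewrite eE IHr ?size_rcons ?em//; exists s => //.
by rewrite cat_rcons.
Qed.

Definition algebraic_projection (I : finType) (A : (I -> R) -> Prop) :=
  exists (J K : finType) (F : K -> (I + J -> R) -> R), (forall k, polyfun (F k)) /\
    forall x, A x <-> exists y, forall k, F k (joint x y) = 0.

(** Quantifier elimination turns the formula that defines the projection into
    a quantifier-free one, whose truth value depends on the signs of the terms
    in its atoms. *)
Lemma tarski_seidenberg (I : finType) (A : (I -> R) -> Prop) :
  algebraic_projection A -> sign_determined A.
Proof.
move=> [J [K [F [Fp AF]]]].
(* variables x_i come first in the environment, then the quantified y_j *)
pose h (k : I + J) : nat :=
  match k with inl i => enum_rank i | inr j => (#|I| + enum_rank j)%N end.
have [t rt tE] : exists2 t : K -> GRing.term R, (forall k, GRing.rterm (t k)) &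
    forall k e, GRing.eval e (t k) = F k (fun i => e`_(h i)).
  have /boolp.choice[t tP] : forall k, exists t, GRing.rterm t /\
      forall e, GRing.eval e t = F k (fun i => e`_(h i)).
    by move=> k; have [t] := polyfun_term h (Fp k); exists t.
  by exists t => k; have [] := tP k.
pose f := foldr (fun k g => And (Equal (t k) (GRing.Const 0)) g) (Bool true) (enum K).
have fr : rformula f.
  by rewrite /f; elim: (enum K) => //= k s ->; rewrite rt.
have fE e : holds e f <-> forall k, F k (fun i => e`_(h i)) = 0.
  have -> : (forall k, F k (fun i => e`_(h i)) = 0) <->
            (forall k, k \in enum K -> F k (fun i => e`_(h i)) = 0).
    by split=> Fe k; [rewrite Fe|apply: Fe; rewrite mem_enum].
  rewrite /f; elim: (enum K) => [|k s IHs] /=; first by split.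
  rewrite IHs tE; split=> [[Fk Fs] k'|Fs].
    by rewrite inE => /orP[/eqP->//|/Fs].
  by split=> [|k' k's]; apply: Fs; rewrite inE ?eqxx// k's orbT.
pose g := foldr (fun n g => Exists n g) f (iota #|I| #|J|).
have gr : rformula g by rewrite /g; elim: (iota _ _).
have [q qE /andP[qfq rq]] : exists2 q : formula R,
    forall e, qf_eval e q <-> holds e g & qf_form q && rformula q.
  exists (quantifier_elim (fun i bc =>
    qe_rcf.qfr_to_formula (@qe_rcf.wproj R i bc)) g) => [e|].
    apply: iff_sym; apply: rwP.
    exact: (quantifier_elim_rformP (@qe_rcf.wf_QE_wproj R)
      (@qe_rcf.valid_QE_wproj R) e gr).
  exact: (quantifier_elim_wf (@qe_rcf.wf_QE_wproj R) gr).
have [m [p [pp pA]]] := sign_determined_qf I qfq rq.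
suff AE x : A x <-> qf_eval (env x) q.
  by exists m, p; split=> // x y xy; rewrite !AE; exact: pA.
rewrite AF qE.
have ex : size (env x) = #|I| by rewrite size_map -cardE.
rewrite holds_exists_block//; split=> [[y Fxy]|[s sJ /fE Fs]].
  exists (env y); first by rewrite size_map -cardE.
  apply/fE => k; rewrite -[RHS](Fxy k); congr (F k _); apply/funext=> -[i|j] /=.
    by rewrite nth_cat ex ltn_ord nth_env.
  by rewrite nth_cat ex ltnNge leq_addr /= addKn nth_env.
exists (fun j => s`_(enum_rank j)) => k; rewrite -[RHS](Fs k); congr (F k _).
apply/funext=> -[i|j] /=; first by rewrite nth_cat ex ltn_ord nth_env.
by rewrite nth_cat ex ltnNge leq_addr /= addKn.
Qed.

End QuantifierElimination.

(** * Lower bounds for the small roots of a family of polynomials *)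

Section LowerBounds.
Variable R : realType.

Lemma horner_le_coef (q : {poly R}) n (B w : R) : (size q <= n)%N ->
  (forall i, `|q`_i| <= B) -> `|w| <= 1 -> `|q.[w]| <= n%:R * B.
Proof.
move=> qn qB w1; rewrite (horner_coef_wide _ qn).
apply: le_trans (ler_norm_sum _ _ _) _.
rewrite mulr_natl -[n in B *+ n]card_ord -sumr_const; apply: ler_sum => i _.
by rewrite normrM -[leRHS]mulr1 ler_pM// normrX exprn_ile1.
Qed.

(** If q_j is the lowest nonzero coefficient, dividing the equation q(w) = 0 by
    w ^ j expresses q_j as w times a bounded quantity. *)
Lemma exists_root_coef_le (q : {poly R}) n (B w : R) : (size q <= n)%N ->
  (forall i, `|q`_i| <= B) -> 0 < w <= 1 -> q != 0 -> q.[w] = 0 ->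
  exists2 j, q`_j != 0 & `|q`_j| <= w * (n%:R * B).
Proof.
move=> + + /andP[w0 w1]; elim/poly_ind: q n => [|q c IHq] n; first by rewrite eqxx.
move=> qn qB qN0 qw; have coefS i : (q * 'X + c%:P)`_i.+1 = q`_i.
  by rewrite coefD coefMX coefC addr0.
have coef0 : (q * 'X + c%:P)`_0 = c by rewrite coefD coefMX coefC add0r.
have qB' i : `|q`_i| <= B by rewrite -coefS.
have szq : (size q <= n)%N.
  have [->|qn0] := eqVneq q 0; first by rewrite size_poly0.
  by rewrite (leq_trans _ qn)// size_MXaddC (negbTE qn0) /= leqnSn.
move: qw; rewrite hornerMXaddC; have [c0|cN0] := eqVneq c 0.
  move=> /eqP; rewrite {1}c0 addr0 mulf_eq0 (gt_eqF w0) orbF => /eqP qw.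
  have [|j qj qjw] := IHq n szq qB' _ qw.
    by apply: contraNneq qN0 => ->; rewrite c0 mul0r addr0.
  by exists j.+1; rewrite coefS.
move=> /eqP; rewrite addr_eq0 => /eqP qw; exists 0%N; rewrite coef0//.
rewrite -normrN -qw normrM mulrC (ger0_norm (ltW w0)) ler_wpM2l ?(ltW w0)//.
by apply: horner_le_coef => //; rewrite gtr0_norm.
Qed.

Lemma coef_bounded (q : {poly R}) : exists2 B, 0 <= B & forall i, `|q`_i| <= B.
Proof.
exists (\sum_(i < size q) `|q`_i|) => [|i]; first exact: sumr_ge0.
have [iq|qi] := ltnP i (size q); last first.
  by rewrite nth_default// normr0 sumr_ge0.
by rewrite (bigD1 (Ordinal iq))//= lerDl sumr_ge0.
Qed.

Lemma horner_bounded (q : {poly R}) :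
  exists2 B, 0 <= B & forall s, 0 < s <= 1 -> `|q.[s]| <= B.
Proof.
have [B B0 qB] := coef_bounded q; exists ((size q)%:R * B).
  exact: mulr_ge0.
by move=> s /andP[s0 s1]; apply: horner_le_coef => //; rewrite gtr0_norm.
Qed.

Lemma exists_nat_ge (x : R) : exists N : nat, x <= N%:R.
Proof.
by exists (Num.Def.archi_bound `|x|); apply: le_trans (ler_norm x) (ltW (archi_boundP _)).
Qed.

Lemma small_scale_le1 (s : R) N : s * N.+1%:R <= 1 -> s <= 1.
Proof.
have [s0|/ltW s0 _] := leP 0 s; last exact: le_trans s0 _.
by apply: le_trans; rewrite -[leLHS]mulr1 ler_wpM2l// ler1n.
Qed.

(** A single natural number controls the exponent and the range of s, so that
    bounds for several functions combine by taking a maximum. *)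
Definition small_lower_bound (N : nat) (a : R -> R) :=
  forall s, 0 < s -> s * N.+1%:R <= 1 -> s ^+ N <= a s.

Lemma small_lower_boundW N M (a : R -> R) : (N <= M)%N ->
  small_lower_bound N a -> small_lower_bound M a.
Proof.
move=> NM aN s s0 sM.
have sN : s * N.+1%:R <= 1.
  by apply: le_trans sM; rewrite ler_wpM2l ?(ltW s0)// ler_nat.
by apply: le_trans (aN _ s0 sN); rewrite ler_wiXn2l ?(ltW s0)// (small_scale_le1 sM).
Qed.

(** Near 0, a polynomial behaves like its lowest nonzero monomial. *)
Lemma poly_small_lower_bound (a : {poly R}) : a != 0 ->
  exists N, small_lower_bound N (fun s => `|a.[s]|).
Proof.
elim/poly_ind: a => [|q c IHq]; first by rewrite eqxx.
have [c0|cN0 _] := eqVneq c 0.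
  rewrite c0 addr0 => qXN0; have [|N qN] := IHq.
    by apply: contraNneq qXN0 => ->; rewrite mul0r.
  exists N.+1 => s s0 sN; rewrite hornerMX normrM (gtr0_norm s0) exprSr.
  rewrite ler_wpM2r ?(ltW s0)// qN//.
  by apply: le_trans sN; rewrite ler_wpM2l ?(ltW s0)// ler_nat.
have [B B0 qB] := horner_bounded q.
(* then |q(s) s + c| >= |c| - B s >= s when s <= |c| / (B + 1) *)
have [N cN] := exists_nat_ge ((B + 1) / `|c|).
exists N.+1 => s s0 sN; rewrite hornerMXaddC.
have s1 := small_scale_le1 sN.
have : s ^+ N.+1 <= s by rewrite -[leRHS]expr1 ler_wiXn2l ?(ltW s0).
have c0 : 0 < `|c| by rewrite normr_gt0.
have : s * (B + 1) <= `|c|.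
  move: cN; rewrite ler_pdivrMr// => cN.
  apply: le_trans (ler_wpM2l (ltW s0) cN) _; rewrite mulrA.
  rewrite -[leRHS]mul1r ler_wpM2r// (le_trans _ sN)// ler_wpM2l ?(ltW s0)//.
  by rewrite ler_nat -addn2 leq_addr.
have : `|q.[s] * s| <= B * s.
  by rewrite normrM (gtr0_norm s0) ler_wpM2r ?(ltW s0)// qB ?s0.
have := lerB_normD c (q.[s] * s).
rewrite [c + _]addrC; move: (`|q.[s] * s|) (`|c|) (`|_ + _|) (s ^+ _) => *.
lra.
Qed.

Lemma uniform_nat (L : finType) (P : L -> nat -> Prop) :
  (forall l M N, (M <= N)%N -> P l M -> P l N) -> (forall l, exists N, P l N) ->
  exists N, forall l, P l N.
Proof.
move=> Pmono /boolp.choice[N PN]; exists (\max_l N l) => l.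
by apply: Pmono (PN l); exact: leq_bigmax.
Qed.

(** For each fixed s, the lowest nonzero coefficient of Q_l(s, -) is the value
    at s of some nonzero polynomial; there are finitely many candidates. *)
Lemma root_small_lower_bound (L : finType) (Q : L -> {poly {poly R}}) :
  exists N : nat, forall s w l, 0 < s -> s * N.+1%:R <= 1 -> 0 < w <= 1 ->
    map_poly (horner_eval s) (Q l) != 0 -> (Q l).[w%:P].[s] = 0 -> s ^+ N <= w.
Proof.
have [N QN] : exists N, forall l (j : 'I_(size (Q l))), (Q l)`_j != 0 ->
    small_lower_bound N (fun s => `|((Q l)`_j).[s]|).
  pose K := {l : L & 'I_(size (Q l))}.
  have [//||N QN] := @uniform_nat K (fun k N => (Q (tag k))`_(tagged k) != 0 ->
    small_lower_bound N (fun s => `|((Q (tag k))`_(tagged k)).[s]|)).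
  - by move=> k M N MN QM /QM; exact: small_lower_boundW.
  - move=> k; have [k0|/poly_small_lower_bound[N kN]] := eqVneq ((Q (tag k))`_(tagged k)) 0.
      by exists 0%N => /eqP[].
    by exists N.
  - by exists N => l j; exact: QN (Tagged (fun l => 'I_(size (Q l))) j).
have [M QM] : exists M : nat, forall l j s, 0 < s <= 1 ->
    `|((Q l)`_j).[s]| <= M%:R.
  have Qlj l (j : 'I_(size (Q l))) : exists M : nat, forall s, 0 < s <= 1 ->
      `|((Q l)`_j).[s]| <= M%:R.
    have [B _ QB] := horner_bounded (Q l)`_j; have [M BM] := exists_nat_ge B.
    by exists M => s s01; exact: le_trans (QB _ s01) BM.
  have [||M QM] := @uniform_nat {l : L & 'I_(size (Q l))} (fun k M =>
      forall s, 0 < s <= 1 -> `|((Q (tag k))`_(tagged k)).[s]| <= M%:R).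
  - by move=> k M N' MN QM s /QM /le_trans -> //; rewrite ler_nat.
  - by move=> k; exact: Qlj.
  exists M => l j s s01; have [jQ|Qj] := ltnP j (size (Q l)); last first.
    by rewrite nth_default// horner0 normr0.
  exact: QM (Tagged (fun l => 'I_(size (Q l))) (Ordinal jQ)) s s01.
pose n := \max_l size (Q l).
(* one more factor s makes up for the constant n * M *)
exists (maxn N.+1 (n * M)) => s w l s0 sK w01 qN0 qw.
have s1 := small_scale_le1 sK.
have scale_le k : (k <= maxn N.+1 (n * M))%N -> s * k%:R <= 1.
  move=> kK; apply: le_trans sK; rewrite ler_wpM2l ?(ltW s0)// ler_nat.
  exact: leqW.
set q := map_poly _ _ in qN0.
have coefq j : q`_j = ((Q l)`_j).[s] by rewrite coef_map.
have szq : (size q <= n)%N.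
  by apply: leq_trans (size_poly _ _) _; exact: leq_bigmax.
have qM j : `|q`_j| <= M%:R by rewrite coefq QM ?s0.
have qw0 : q.[w] = 0.
  rewrite -[LHS]/(q.[w]) -qw.
  by rewrite -[RHS]/(horner_eval s _) -[in RHS]horner_map /= horner_evalE hornerC.
have [j qj qjw] := exists_root_coef_le szq qM w01 qN0 qw0.
have QjN0 : (Q l)`_j != 0 by apply: contraNneq qj; rewrite coefq => ->; rewrite horner0.
have jQ : (j < size (Q l))%N.
  by rewrite ltnNge; apply: contraNN QjN0 => Qj; rewrite nth_default.
have sNw : s ^+ N <= w * (n * M)%:R.
  rewrite natrM; apply: le_trans qjw; rewrite coefq.
  by apply: (QN l (Ordinal jQ)) => //; apply: scale_le; rewrite leq_max leqnn.
apply: (@le_trans _ _ (s ^+ N.+1)).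
  by rewrite ler_wiXn2l ?(ltW s0)// leq_maxl.
rewrite exprS; apply: le_trans (ler_wpM2l (ltW s0) sNw) _.
rewrite mulrCA -[leRHS]mulr1 ler_wpM2l ?scale_le ?leq_maxr//.
by case/andP: w01 => /ltW.
Qed.

End LowerBounds.

(** * A Lojasiewicz inequality *)

(** Points are taken in a topological space T with coordinates [co], so that the
    results apply to sets of matrices as well as to sets of row vectors. *)
Section Lojasiewicz.
Variables (R : realType) (I : finType) (T : topologicalType) (co : T -> I -> R).
Hypothesis co_continuous : forall i, continuous (co^~ i).
Hypothesis co_surj : forall x, exists t, co t = x.

Lemma closed_polyfun_ge0 (h : (I -> R) -> R) :
  polyfun h -> closed [set t | 0 <= h (co t)].
Proof.
move=> /(polyfun_continuous co_continuous) /continuous_closedP/(_ _ (@closed_ge R 0)).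
exact.
Qed.

Lemma polyfun_attains_min (F : set T) (h : (I -> R) -> R) t : compact F -> polyfun h ->
  F t -> exists2 u, F u & forall v, F v -> h (co u) <= h (co v).
Proof.
move=> cF ph Ft.
have [||u uF umin] := @compact_EVT_min T R (h \o co) F _ cF.
- by exists t.
- exact/continuous_subspaceT/polyfun_continuous.
by exists u => [|v Fv]; [rewrite inE in uF|apply: umin; rewrite inE].
Qed.

Lemma compact_polyfun_ge0 (F : set T) (h : (I -> R) -> R) : compact F -> polyfun h ->
  compact (F `&` [set t | 0 <= h (co t)]).
Proof. by move=> cF ph; exact/compact_closedI/closed_polyfun_ge0. Qed.

Lemma compact_polyfuns_ge0 (L : finType) (F : set T) (p : L -> (I -> R) -> R) :
  compact F -> (forall l, polyfun (p l)) ->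
  compact (F `&` [set t | forall l, 0 <= p l (co t)]).
Proof.
move=> cF pp; rewrite (_ : [set t | _] = \bigcap_l [set t | 0 <= p l (co t)]).
  by apply: compact_closedI => //; apply: closed_bigI => l _; exact: closed_polyfun_ge0.
by apply/seteqP; split=> t /= pt l => [_|]; exact: pt.
Qed.

(** A polynomial that is zero, or nonzero at w, has a constant sign on some
    interval that ends at w. *)
Lemma sign_change_root (L : finType) (q : L -> {poly R}) (w : R) :
  (forall v, v < w -> exists l, Num.sg (q l).[w] != Num.sg (q l).[v]) ->
  exists2 l, q l != 0 & (q l).[w] = 0.
Proof.
move=> wmin; apply: contrapT => noroot.
have : \forall v \near w^'-, forall l, Num.sg (q l).[w] = Num.sg (q l).[v].
  apply: filter_forall => l.
  have [->|qN0] := eqVneq (q l) 0; first by near=> v; rewrite !horner0.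
  have qw : (q l).[w] != 0 by apply: contra_notN noroot => /eqP; exists l.
  have qc : (q l).[v] @[v --> w^'-] --> (q l).[w].
    by apply: cvg_at_left_filter; exact: continuous_horner.
  have [q0|q0|q0] := ltgtP (q l).[w] 0; last by rewrite q0 eqxx in qw.
    near=> v; rewrite (ltr0_sg q0) ltr0_sg//; near: v.
    exact: (cvgr_lt _ qc).
  near=> v; rewrite (gtr0_sg q0) gtr0_sg//; near: v.
  exact: (cvgr_gt _ qc).
move=> H; have /filter_ex[v [vw vsg]] : \forall v \near w^'-,
    v < w /\ forall l, Num.sg (q l).[w] = Num.sg (q l).[v].
  near=> v; split; last by near: v.
  by near: v; exact: nbhs_left_lt.
by have [l] := wmin _ vw; rewrite vsg eqxx.
Unshelve. all: by end_near.
Qed.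

Variables (A : set T) (P : (I -> R) -> Prop).
Hypothesis Acompact : compact A.
Hypothesis AE : forall t, A t <-> P (co t).
Hypothesis Pproj : algebraic_projection P.

(** For small s > 0, the minimum w of f on the level set g = s is positive; it
    is a root of some polynomial in w as a sign has to change there, hence is at
    least a power of s.  For larger s, the compactness of F gives a constant
    lower bound of f. *)
Lemma lojasiewicz (L : finType) (p : L -> (I -> R) -> R) (f g : (I -> R) -> R) :
  let F := A `&` [set t | forall l, 0 <= p l (co t)] in
  (forall l, polyfun (p l)) -> polyfun f -> polyfun g ->
  (forall t, F t -> 0 <= f (co t) /\ 0 <= g (co t)) ->
  (forall t, F t -> f (co t) = 0 -> g (co t) = 0) ->
  exists N K, forall t, F t -> g (co t) ^+ N.+1 <= K * f (co t).
Proof.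
move=> F pp pf pg fg0 fg; have cF : compact F by exact: compact_polyfuns_ge0.
(* The values (g, f) on F.  The coordinate [true] is the value of f; the
   inequalities p_l >= 0 are written p_l = y ^ 2 with one more y for each l. *)
pose D (z : bool -> R) := exists2 t, F t & z true = f (co t) /\ z false = g (co t).
have [M [q [pq qD]]] : sign_determined D.
  apply: tarski_seidenberg.
  have [J [K [H [pH PH]]]] := Pproj.
  pose x0 (u : bool + (I + (J + L)) -> R) i := u (inr (inl i)).
  exists (I + (J + L))%type, (K + (L + bool))%type, (fun k u =>
    match k with
    | inl k => H k (fun ij => u (inr (match ij with
                 inl i => inl i | inr j => inr (inl j) end)))
    | inr (inl l) => p l (x0 u) + - u (inr (inr (inr l))) ^+ 2
    | inr (inr true) => f (x0 u) + - u (inl true)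
    | inr (inr false) => g (x0 u) + - u (inl false)
    end); split.
    have pv i := @polyfun_var R (bool + (I + (J + L))) i.
    move=> [k|[l|[]]] /=.
    - by apply: (polyfun_comp (pH k)) => ij; exact: pv.
    - apply: polyfun_add; last exact/polyfun_opp/polyfun_exp.
      by apply: (polyfun_comp (pp l)) => i; exact: pv.
    - apply: polyfun_add; last exact/polyfun_opp.
      by apply: (polyfun_comp pf) => i; exact: pv.
    - apply: polyfun_add; last exact/polyfun_opp.
      by apply: (polyfun_comp pg) => i; exact: pv.
  move=> z; split=> [[t [At pt] [zf zg]]|[y yH]].
    move: At => /AE/PH[y yH]; exists (joint (co t) (joint y (fun l => Num.sqrt (p l (co t))))).
    move=> [k|[l|[]]] /=.
    - by rewrite -[RHS](yH k); congr (H k _); apply/funext => -[].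
    - by rewrite sqr_sqrtr ?pt// -[X in X + _]/(p l (co t)) subrr.
    - by rewrite zf -[X in X + _]/(f (co t)) subrr.
    - by rewrite zg -[X in X + _]/(g (co t)) subrr.
  have [t tx] := co_surj (fun i => y (inl i)); exists t; rewrite ?tx.
    split=> [|l /=].
      apply/AE/PH; exists (fun j => y (inr (inl j))) => k.
      by rewrite tx -[RHS](yH (inl k)); congr (H k _); apply/funext => -[].
    by have /eqP := yH (inr (inl l)); rewrite tx subr_eq0 => /eqP ->; exact: sqr_ge0.
  split; apply/esym/eqP; rewrite -subr_eq0; apply/eqP.
    exact: yH (inr (inr true)).
  exact: yH (inr (inr false)).
have /boolp.choice[Q qQ] := fun l => polyfun2_horner (pq l).
have [N QN] := root_small_lower_bound Q.
have [G [G1 gG]] : exists G, 1 <= G /\ forall t, F t -> g (co t) <= G.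
  have [[t0 Ft0]|F0] := pselect (F !=set0); last first.
    by exists 1; split=> // t Ft; case: F0; exists t.
  have [t1 _ t1max] := polyfun_attains_min cF (polyfun_opp pg) Ft0.
  exists (Num.max 1 (g (co t1))); split=> [|t Ft]; first by rewrite le_max lexx.
  by rewrite le_max -[X in _ || X]lerN2 t1max// orbT.
pose s0 : R := N.+1%:R^-1.
have s00 : 0 < s0 by rewrite invr_gt0 ltr0n.
(* the part of F where g is not small *)
have [m m0 fm] : exists2 m, 0 < m & forall t, F t -> s0 <= g (co t) -> m <= f (co t).
  have pgs : polyfun (fun x => g x + - s0) by exact/polyfun_add/polyfun_cst.
  have cF' := compact_polyfun_ge0 cF pgs.
  have [[t0 Ft0]|F0] := pselect (F `&` [set t | 0 <= g (co t) + - s0] !=set0); last first.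
    by exists 1 => // t Ft gt; case: F0; exists t; split=> //=; rewrite subr_ge0.
  have [t1 [Ft1 /= gt1] t1min] := polyfun_attains_min cF' pf Ft0.
  exists (f (co t1)) => [|t Ft gt]; last by apply: t1min; split=> //=; rewrite subr_ge0.
  rewrite lt0r (fg0 _ Ft1).1 andbT; apply: contraTneq gt1 => /(fg _ Ft1) ->.
  by rewrite add0r oppr_ge0 -ltNge.
have mG0 : 0 <= G ^+ N.+1 / m by rewrite divr_ge0 ?(ltW m0) ?exprn_ge0// (le_trans _ G1).
exists N, (1 + G ^+ N.+1 / m) => t Ft.
have [f0 g0] := fg0 _ Ft.
have [gs|sg] := leP s0 (g (co t)).
  apply: (@le_trans _ _ (G ^+ N.+1 / m * f (co t))).
    apply: (@le_trans _ _ (G ^+ N.+1)); first by rewrite lerXn2r ?nnegrE ?gG// (le_trans _ G1).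
    by rewrite mulrAC ler_pdivlMr// ler_wpM2l ?fm// exprn_ge0// (le_trans _ G1).
  by rewrite ler_wpM2r// lerDr.
have [gt0|gtN0] := eqVneq (g (co t)) 0.
  by rewrite gt0 expr0n /= mulr_ge0// addr_ge0.
have gt0 : 0 < g (co t) by rewrite lt0r gtN0.
apply: (@le_trans _ _ (f (co t))); last by rewrite -[leLHS]mul1r ler_wpM2r// lerDl.
(* the level set of g through t, and a point t1 where f is least on it *)
have cF' : compact (F `&` [set u | 0 <= - (g (co u) + - g (co t)) ^+ 2]).
  apply: (compact_polyfun_ge0 (h := fun x => - (g x + - g (co t)) ^+ 2)) => //.
  by apply/polyfun_opp/polyfun_exp/polyfun_add => //; exact: polyfun_cst.
have [|t1 [Ft1 /= gt1] t1min] := polyfun_attains_min (t := t) cF' pf.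
  by split=> //=; rewrite subrr expr0n /= oppr0.
have {gt1} gt1 : g (co t1) = g (co t).
  apply/eqP; rewrite -subr_eq0 -sqrf_eq0 eq_le sqr_ge0 andbT.
  by rewrite -oppr_ge0.
have f1 : 0 < f (co t1).
  rewrite lt0r (fg0 _ Ft1).1 andbT; apply: contraNneq gtN0 => /(fg _ Ft1) <-.
  by rewrite gt1.
have sN : g (co t) * N.+1%:R <= 1.
  by rewrite -ler_pdivlMr ?ltr0n// div1r ltW.
have g1 := small_scale_le1 sN.
apply: (@le_trans _ _ (f (co t1))); last first.
  by apply: t1min; split=> //=; rewrite subrr expr0n /= oppr0.
apply: (@le_trans _ _ (g (co t) ^+ N)); first by rewrite ler_wiXn2l// ltW.
have [f1le|f1ge] := leP (f (co t1)) 1; last first.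
  by apply: le_trans (ltW f1ge); exact: exprn_ile1.
have [v vw|l ql0 qlw] := @sign_change_root M
    (fun l => map_poly (horner_eval (g (co t))) (Q l)) (f (co t1)).
  apply: contrapT => nosg.
  pose z v (b : bool) := if b then v else g (co t).
  have [t2 Ft2 [/= ft2 gt2]] : D (z v).
    apply: (qD (z (f (co t1)))); last by exists t1.
    move=> l; rewrite !qQ /=; apply/eqP/negPn/negP => lsg; apply: nosg; exists l.
    have hE w : (map_poly (horner_eval (g (co t))) (Q l)).[w] = (Q l).[w%:P].[g (co t)].
      by rewrite -[RHS]/(horner_eval _ _) -[in RHS]horner_map /= horner_evalE hornerC.
    by rewrite !hE.
  suff : f (co t1) <= v by rewrite leNgt vw.
  rewrite ft2; apply: t1min; split=> //=.
  by rewrite -gt2 subrr expr0n /= oppr0.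
apply: (QN _ _ l) => //; first by rewrite f1.
by rewrite -qlw -[LHS]/(horner_eval _ _) -[in LHS]horner_map /= horner_evalE hornerC.
Qed.

End Lojasiewicz.

(** * Compact semialgebraic sets as projections of bounded algebraic sets *)

Section ClosedForm.
Variables (R : realType) (I : finType) (T : topologicalType) (co : T -> I -> R).
Hypothesis co_continuous : forall i, continuous (co^~ i).
Hypothesis co_surj : forall x, exists t, co t = x.
Variables (A : set T) (P : (I -> R) -> Prop).
Hypothesis Acompact : compact A.
Hypothesis AE : forall t, A t <-> P (co t).
Hypothesis Pproj : algebraic_projection P.

Definition sign_of (o : option bool) : R := if o is Some b then (-1) ^+ b else 0.

Lemma sign_ofP (x : R) : exists o, Num.sg x = sign_of o.
Proof.
have [x0|x0|->] := ltgtP x 0.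
- by exists (Some true); rewrite ltr0_sg.
- by exists (Some false); rewrite gtr0_sg.
- by exists None; rewrite sgr0.
Qed.

(** The disjunction of the inequalities h_k <= 0 holds on A and fails on the
    cell.  Either some strict inequality of the cell fails in the weak form, or
    the point lies in the set where the Lojasiewicz inequality g ^ N <= K f
    holds; on the cell, f = 0 and g > 0. *)
Lemma separate_cell (L : finType) (p : L -> (I -> R) -> R) (s : {ffun L -> option bool}) :
  (forall l, polyfun (p l)) ->
  (forall t, A t -> ~ forall l, Num.sg (p l (co t)) = sign_of (s l)) ->
  exists h : option L -> (I -> R) -> R, [/\ forall k, polyfun (h k),
    forall t, A t -> exists k, h k (co t) <= 0 &
    forall x k, (forall l, Num.sg (p l x) = sign_of (s l)) -> 0 < h k x].
Proof.
move=> pp cellA.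
pose p' l x := sign_of (s l) * p l x.
pose f x := \sum_(l | s l == None) p l x ^+ 2.
pose g x := \prod_(l | s l != None) p' l x.
have pp' l : polyfun (p' l) by apply: polyfun_mul => //; exact: polyfun_cst.
have pf : polyfun f by apply: polyfun_sum => l _; exact: polyfun_exp.
have pg : polyfun g by apply: polyfun_prod => l _; exact: pp'.
have f_ge0 x : 0 <= f x by apply: sumr_ge0 => l _; exact: sqr_ge0.
have cellE x : f x = 0 -> (forall l, s l != None -> 0 < p' l x) ->
    forall l, Num.sg (p l x) = sign_of (s l).
  move=> f0 p'0 l; have [sl|slN] := eqVneq (s l) None.
    have /psumr_eq0P/(_ l) : f x = 0 by [].
    rewrite sl eqxx => /(_ (fun _ _ => sqr_ge0 _) isT)/eqP; rewrite sqrf_eq0 => /eqP ->.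
    by rewrite sgr0.
  have := p'0 l slN; rewrite /p'; case: (s l) slN => [[]|]//= _.
    by rewrite expr1 mulN1r oppr_gt0 => /ltr0_sg.
  by rewrite expr0 mul1r => /gtr0_sg.
have [||N [K fgK]] := lojasiewicz co_continuous co_surj Acompact AE Pproj pp' pf pg.
- by move=> t [_ p'0]; split=> //; apply: prodr_ge0 => l _; exact: p'0.
- move=> t [At p'0] ft0; apply/eqP; apply: contra_notT (cellA _ At) => gN0.
  apply: cellE => // l sl; rewrite lt0r p'0 andbT.
  by have /prodf_neq0/(_ l) := gN0; apply.
pose h k x := if k is Some l then (if s l == None then 1 else p' l x)
              else g x ^+ N.+1 + - (K * f x).
exists h; split.
- move=> [l|]; rewrite /h; first by case: (s l == None) => //; exact: polyfun_cst.
  apply: polyfun_add; first exact: polyfun_exp.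
  by apply/polyfun_opp/polyfun_mul => //; exact: polyfun_cst.
- move=> t At; apply: contrapT => /forallNP hN.
  have h0 k : ~~ (h k (co t) <= 0) by apply/negP; exact: hN.
  have p'0 l : 0 <= p' l (co t).
    have := h0 (Some l); rewrite /h; case: eqP => [sl _|_]; last by rewrite -ltNge => /ltW.
    by rewrite /p' sl mul0r.
  by have := h0 None; rewrite /h subr_le0 fgK.
- move=> x k xs; have p'0 l : s l != None -> 0 < p' l x.
    have := xs l; rewrite /p'; case: (s l) => [b|]//= xb _.
    by rewrite -xb -normrEsg normr_gt0 -sgr_eq0 xb signr_eq0.
  rewrite /h; case: k => [l|]; first by case: ifPn => // /p'0.
  have -> : f x = 0.
    by apply: big1 => l /eqP sl; have /eqP := xs l; rewrite sl sgr_eq0 => /eqP ->; rewrite expr0n.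
  by rewrite mulr0 oppr0 addr0 exprn_gt0// prodr_gt0.
Qed.

(** A is the intersection, over the sign cells that miss A, of closed sets that
    contain A and miss the cell. *)
Lemma compact_semialgebraic_inequalities : exists (S K : finType)
    (h : S -> K -> (I -> R) -> R), (forall s k, polyfun (h s k)) /\
    forall t, A t <-> forall s, exists k, h s k (co t) <= 0.
Proof.
have [L [p [pp pP]]] := tarski_seidenberg Pproj.
pose cell s x := forall l, Num.sg (p l x) = sign_of (s l).
have /boolp.choice[h hP] : forall s : {ffun L -> option bool},
    exists h : option L -> (I -> R) -> R, [/\ forall k, polyfun (h k),
    forall t, A t -> exists k, h k (co t) <= 0 &
    (forall t, A t -> ~ cell s (co t)) -> forall x k, cell s x -> 0 < h k x].
  move=> s; have [sA|sA] := pselect (forall t, A t -> ~ cell s (co t)).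
    by have [h [hp hA hs]] := separate_cell pp sA; exists h.
  exists (fun _ _ => 0); split=> // [k|t _]; first exact: polyfun_cst.
  by exists None.
exists {ffun L -> option bool}, (option L), h; split=> [s k|t].
  by have [] := hP s.
split=> [At s|ht]; first by have [_ + _] := hP s; apply.
apply: contrapT => nAt.
have /boolp.choice[s sP] := fun l => sign_ofP (p l (co t)).
have ts : cell [ffun l => s l] (co t) by move=> l; rewrite ffunE.
have [k] := ht [ffun l => s l]; have [_ _ hs] := hP [ffun l => s l].
rewrite leNgt hs// => u Au us; apply: nAt; apply/AE.
by apply: (pP (co u)); [move=> l; rewrite us ts|exact/AE].
Qed.

(** A disjunction of inequalities h_k <= 0 is the equation
    \prod_k (h_k + u_k ^ 2) = 0 in new unknowns u_k, for which the square roots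
    of -h_k can be taken; the polynomials h_k are bounded on A. *)
Lemma compact_semialgebraic_bounded_equations (b : R) :
  (forall t, A t -> forall i, `|co t i| <= b) ->
  exists (U K : finType) (F : K -> (I + U -> R) -> R) (C : R),
    [/\ 1 <= C, forall k, polyfun (F k) &
    forall t, A t <-> exists2 u, (forall j, `|u j| <= C) &
                                 forall k, F k (joint (co t) u) = 0].
Proof.
move=> Ab; have [S [K [h [hp hA]]]] := compact_semialgebraic_inequalities.
have [M hM] : exists M, forall (sk : S * K) t, A t -> `|h sk.1 sk.2 (co t)| <= M%:R.
  apply: uniform_nat => [sk M N MN HM t /HM/le_trans->//|[s k]].
    by rewrite ler_nat.
  have [B _ hB] := polyfun_bounded b (hp s k); have [M BM] := exists_nat_ge B.
  by exists M => t /Ab tb; exact: le_trans (hB _ tb) BM.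
exists (S * K)%type, S, (fun s z => \prod_k (h s k (z \o inl) + z (inr (s, k)) ^+ 2)), M.+1%:R.
split=> [|s|t]; first by rewrite ler1n.
  apply: polyfun_prod => k _; apply: polyfun_add; first exact: polyfun_reindex.
  exact/polyfun_exp/polyfun_var.
split=> [At|[u _ ut]].
  exists (fun sk => Num.sqrt (- h sk.1 sk.2 (co t))) => [sk|s].
    rewrite ger0_norm ?sqrtr_ge0//.
    have [h0|h0] := ltP 0 (h sk.1 sk.2 (co t)).
      by rewrite ler0_sqrtr// ?oppr_le0// ltW.
    have hm := hM sk t At; rewrite ler0_norm// in hm.
    apply: le_trans (ler_wsqrtr hm) _.
    rewrite -[leRHS]ger0_norm// -sqrtr_sqr ler_wsqrtr// expr2 -natrM ler_nat.
    exact: leq_trans (leqnSn M) (leq_pmulr _ _).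
  have [k hk] := (hA t).1 At s; apply/eqP/prodf_eq0; exists k => //=.
  by rewrite sqr_sqrtr ?oppr_ge0// -[X in X - _]/(h s k (co t)) subrr.
apply/hA => s; have /eqP/prodf_eq0[k _ /= hk] := ut s.
exists k; move: hk; rewrite addr_eq0 => /eqP hk.
by rewrite -[X in X <= _]/(h s k (co t)) in hk *; rewrite hk oppr_le0 sqr_ge0.
Qed.

End ClosedForm.

(** * Unit vectors and geodesic distance *)

Section SphereGeometry.
Variables (R : realType) (d : nat).
Implicit Types x y z : 'rV[R]_d.+1.

Lemma dotprodC x y : dotprod x y = dotprod y x.
Proof. by apply: eq_bigr => j _; rewrite mulrC. Qed.

Lemma dotprodDl x y z : dotprod (x + y) z = dotprod x z + dotprod y z.
Proof. by rewrite -big_split; apply: eq_bigr => j _; rewrite mxE mulrDl. Qed.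

Lemma dotprodZl a x y : dotprod (a *: x) y = a * dotprod x y.
Proof. by rewrite mulr_sumr; apply: eq_bigr => j _; rewrite mxE mulrA. Qed.

Lemma dotprodDr x y z : dotprod z (x + y) = dotprod z x + dotprod z y.
Proof. by rewrite ![dotprod z _]dotprodC dotprodDl. Qed.

Lemma dotprodZr a x y : dotprod x (a *: y) = a * dotprod x y.
Proof. by rewrite ![dotprod x _]dotprodC dotprodZl. Qed.

Lemma dotprod_ge0 x : 0 <= dotprod x x.
Proof. by apply: sumr_ge0 => j _; exact: sqr_ge0. Qed.

Lemma dotprod_eq0 x : (dotprod x x == 0) = (x == 0).
Proof.
apply/eqP/eqP => [x0|->]; last by rewrite /dotprod big1// => j _; rewrite mxE mul0r.
apply/rowP => j; rewrite mxE; apply/eqP; rewrite -sqrf_eq0 expr2; apply/eqP.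
by apply: (psumr_eq0P _ x0) => // k _; exact: sqr_ge0.
Qed.

Lemma dotprod_gt0 x : x != 0 -> 0 < dotprod x x.
Proof. by move=> x0; rewrite lt0r dotprod_ge0 dotprod_eq0 x0. Qed.

Lemma cauchy_schwarz_sphere x y : sphere x -> sphere y -> -1 <= dotprod x y <= 1.
Proof.
rewrite /sphere /= => x1 y1.
have := dotprod_ge0 (x - y); have := dotprod_ge0 (x + y).
rewrite !(dotprodDl, dotprodDr) -scaleN1r !(dotprodZl, dotprodZr) x1 y1 [dotprod y x]dotprodC.
by move=> *; apply/andP; split; lra.
Qed.

Lemma sphere_dotprod1 x y : sphere x -> sphere y -> dotprod x y = 1 -> x = y.
Proof.
rewrite /sphere /= => x1 y1 xy; apply/eqP; rewrite -subr_eq0 -dotprod_eq0.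
rewrite !(dotprodDl, dotprodDr) -scaleN1r !(dotprodZl, dotprodZr) x1 y1 xy dotprodC xy.
by apply/eqP; lra.
Qed.

Lemma sphere_coord_le1 x j : sphere x -> `|x 0 j| <= 1.
Proof.
rewrite /sphere /= /dotprod => x1.
rewrite -[leRHS]sqrtr1 -sqrtr_sqr ler_wsqrtr// -x1 (bigD1 j)//= -expr2.
by rewrite lerDl sumr_ge0// => k _; rewrite -expr2 sqr_ge0.
Qed.

Lemma geodistC x y : geodist x y = geodist y x.
Proof. by rewrite /geodist dotprodC. Qed.

Lemma geodist_acos x y c : sphere x -> sphere y -> -1 <= c <= 1 ->
  geodist x y = acos c -> dotprod x y = c.
Proof.
move=> xS yS c1 xy; rewrite -(acosK c1) -xy /geodist acosK//.
exact: cauchy_schwarz_sphere.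
Qed.

Lemma geodist_eq0 x y : sphere x -> sphere y -> geodist x y = 0 -> x = y.
Proof.
move=> xS yS; rewrite -acos1 => /(geodist_acos xS yS) xy.
by apply: sphere_dotprod1 => //; apply: xy; rewrite lexx andbT; lra.
Qed.

Definition normalize x := (Num.sqrt (dotprod x x))^-1 *: x.

Lemma sphere_normalize x : x != 0 -> sphere (normalize x).
Proof.
move=> /dotprod_gt0 x0; rewrite /sphere /= dotprodZl dotprodZr mulrA -expr2 exprVn.
by rewrite sqr_sqrtr ?ltW// mulVf// gt_eqF.
Qed.

Lemma normalize_scale_gt0 x : x != 0 -> 0 < (Num.sqrt (dotprod x x))^-1.
Proof. by move=> /dotprod_gt0 x0; rewrite invr_gt0 sqrtr_gt0. Qed.

(** Two linear equations have a nonzero solution in dimension at least 3. *)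
Lemma exists_orthogonal x y : (2 <= d)%N ->
  exists z, [/\ sphere z, dotprod z x = 0 & dotprod z y = 0].
Proof.
move=> d2; pose M := row_mx x^T y^T.
have kN0 : kermx M != 0.
  rewrite kermx_eq0 /row_free neq_ltn (leq_ltn_trans (rank_leq_col M))//.
have [i /eqP/eqP kiN0] : exists i, row i (kermx M) != 0.
  apply/existsP; apply: contra_neqT kN0 => /existsPn k0.
  by apply/row_matrixP => i; rewrite row0; apply/eqP; have := k0 i; rewrite negbK.
set z := row i (kermx M) in kiN0.
have : z *m M = 0 by rewrite -row_mul mulmx_ker row0.
rewrite mul_mx_row -row_mx0 => /eq_row_mx[zx zy].
have dotE u v : dotprod u v = (u *m v^T) 0 0.
  by rewrite mxE; apply: eq_bigr => j _; rewrite mxE.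
have zx0 : dotprod z x = 0 by rewrite dotE zx mxE.
have zy0 : dotprod z y = 0 by rewrite dotE zy mxE.
exists (normalize z); split; first exact: sphere_normalize.
  by rewrite dotprodZl zx0 mulr0.
by rewrite dotprodZl zy0 mulr0.
Qed.

End SphereGeometry.

(** * Relations defined by bars *)

Definition spoint (R : realType) (d : nat) := {x : 'rV[R]_d.+1 | dotprod x x == 1}.

Section Definable.
Variables (R : realType) (d : nat).
Notation S := (spoint R d).

Lemma spointP (p : S) : sphere (val p).
Proof. exact/eqP/(valP p). Qed.

Definition endpoint (I J : Type) (x : I -> S) (y : J -> S) (a : (I + J) + S) : S :=
  match a with inl k => joint x y k | inr p => p end.

(** An abstract linkage: no condition is put on the graph, several bars may join
    the same two points, and a bar may end at a constant of the sphere.  A bar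
    is given by the cosine of its length. *)
Record bar_system (I : Type) := BarSystem {
  aux : finType;
  bar : finType;
  bar_end : bar -> bool -> (I + aux) + S;
  bar_cos : bar -> R;
  bar_cos_itv : forall k, -1 <= bar_cos k <= 1
}.

Definition satisfies I (D : bar_system I) (x : I -> S) (y : aux D -> S) : Prop :=
  forall k : bar D, dotprod (val (endpoint x y (bar_end k false)))
                            (val (endpoint x y (bar_end k true))) = bar_cos k.

Definition definable (I : Type) (P : (I -> S) -> Prop) : Prop :=
  exists D : bar_system I, forall x, P x <-> exists y, @satisfies I D x y.

(** The points to which a bar can be attached: variables of the context, and
    constants.  A term is kept as a function of the assignment, so that the
    relations to be shown definable can be written as they are. *)
Definition is_term (I : Type) (a : (I -> S) -> S) : Prop :=
  (exists i, a = (fun x => x i)) \/ (exists p, a = (fun=> p)).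

Lemma is_term_var I i : @is_term I (fun x => x i).
Proof. by left; exists i. Qed.

Lemma is_term_const I p : @is_term I (fun=> p).
Proof. by right; exists p. Qed.

Lemma is_term_comp I I' (h : I -> I') a : is_term a -> is_term (fun x => a (x \o h)).
Proof.
by move=> [[i ->]|[p ->]]; [exact: (is_term_var (h i))|exact: is_term_const].
Qed.

Lemma definable_dotprod I (a b : (I -> S) -> S) c : is_term a -> is_term b ->
  -1 <= c <= 1 -> definable (fun x => dotprod (val (a x)) (val (b x)) = c).
Proof.
have code t : is_term t -> exists u : (I + void) + S, forall x y, endpoint x y u = t x.
  by move=> [[i ->]|[p ->]]; [exists (inl (inl i))|exists (inr p)].
move=> /code[u ua] /code[v vb] c1.
exists (@BarSystem I void unit (fun _ s => if s then v else u) (fun=> c) (fun=> c1)) => x.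
split=> [abc|[y /(_ tt)]]; last by rewrite ua vb.
by exists (fun j : void => match j with end) => -[]; rewrite /= ua vb.
Qed.

Lemma definable_iff I (P Q : (I -> S) -> Prop) : (forall x, P x <-> Q x) ->
  definable Q -> definable P.
Proof. by move=> PQ [D QD]; exists D => x; rewrite PQ. Qed.

Lemma definable_comp I I' (h : I -> I') (P : (I -> S) -> Prop) :
  definable P -> definable (fun x => P (x \o h)).
Proof.
move=> [[J K e c c1] PD].
exists (@BarSystem I' J K (fun k s => match e k s with
  | inl (inl i) => inl (inl (h i)) | inl (inr j) => inl (inr j) | inr p => inr p end) c c1).
move=> x; have endE (y : J -> S) a : endpoint x y (match a with
    inl (inl i) => inl (inl (h i)) | inl (inr j) => inl (inr j) | inr p => inr p end) =
    endpoint (x \o h) y a.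
  by case: a => [[]|].
by rewrite PD; split=> -[y yP]; exists y => k; have := yP k; rewrite /= !endE.
Qed.

Lemma definable_forall I (L : finType) (P : L -> (I -> S) -> Prop) :
  (forall l, definable (P l)) -> definable (fun x => forall l, P l x).
Proof.
move=> /boolp.choice[D PD].
exists (@BarSystem I {l & aux (D l)} {l & bar (D l)}
  (fun k s => match bar_end (tagged k) s with
   | inl (inl i) => inl (inl i)
   | inl (inr j) => inl (inr (Tagged (fun l => aux (D l)) j))
   | inr p => inr p end)
  (fun k => bar_cos (tagged k)) (fun k => bar_cos_itv (tagged k))) => x.
have endE y l k s : endpoint x y (match @bar_end _ (D l) k s with
   | inl (inl i) => inl (inl i)
   | inl (inr j) => inl (inr (Tagged (fun l => aux (D l)) j))
   | inr p => inr p end) = endpoint x (fun j => y (Tagged (fun l => aux (D l)) j)) (bar_end k s).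
  by case: (bar_end k s) => [[]|].
split=> [Px|[y yP] l].
  have {Px} y l : {y | satisfies x y} := cid ((PD l x).1 (Px l)).
  exists (fun j => sval (y (tag j)) (tagged j)) => -[l k] /=.
  by rewrite !endE; have := svalP (y l) k.
apply/PD; exists (fun j => y (Tagged (fun l => aux (D l)) j)) => k.
by rewrite -!endE; exact: (yP (Tagged (fun l => bar (D l)) k)).
Qed.

Lemma definable_and I (P Q : (I -> S) -> Prop) :
  definable P -> definable Q -> definable (fun x => P x /\ Q x).
Proof.
move=> dP dQ; apply: (@definable_iff _ _ (fun x => forall b, (if b then P else Q) x)).
  by move=> x; split=> [[Px Qx] []//|PQ]; split; [exact: (PQ true)|exact: (PQ false)].
by apply: definable_forall => -[].
Qed.

(** A context is a type of variables; the variables bound by the quantifier are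
    added to it with a disjoint sum. *)
Lemma definable_exists I (J : finType) (P : (I -> S) -> (J -> S) -> Prop) :
  definable (fun z : I + J -> S => P (z \o inl) (z \o inr)) ->
  definable (fun x => exists y, P x y).
Proof.
move=> [[J' K e c c1] PD].
exists (@BarSystem I (J + J')%type K (fun k s => match e k s with
   | inl (inl (inl i)) => inl (inl i)
   | inl (inl (inr j)) => inl (inr (inl j))
   | inl (inr j) => inl (inr (inr j))
   | inr p => inr p end) c c1) => x.
have endE y y' a : endpoint x (joint y y') (match a with
   | inl (inl (inl i)) => inl (inl i)
   | inl (inl (inr j)) => inl (inr (inl j))
   | inl (inr j) => inl (inr (inr j))
   | inr p => inr p end) = endpoint (joint x y) y' a.
  by case: a => [[[]|]|].
split=> [[y Pxy]|[y yP]].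
  have /PD[y' y'P] : P (joint x y \o inl) (joint x y \o inr) by [].
  by exists (joint y y') => k; have := y'P k; rewrite /= !endE.
exists (y \o inl); apply/(PD (joint x (y \o inl))); exists (y \o inr) => k.
have := yP k; rewrite /= (_ : y = joint (y \o inl) (y \o inr)) ?endE//.
by apply/funext => -[].
Qed.

Lemma definable_exists1 I (P : (I -> S) -> S -> Prop) :
  definable (fun z : I + unit -> S => P (z \o inl) (z (inr tt))) ->
  definable (fun x => exists y, P x y).
Proof.
move=> dP; apply: (@definable_iff _ _ (fun x => exists y : unit -> S, P x (y tt))).
  by move=> x; split=> [[y Pxy]|[y Pxy]]; [exists (fun=> y)|exists (y tt)].
exact: (@definable_exists I unit (fun x y => P x (y tt))).
Qed.

End Definable.

(** * From bar systems to linkages *)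

(** In a linkage, a set of two vertices carries at most one length, there are no
    loops, and the graph is connected.  To achieve this, each bar k gets two
    vertices (k, false) and (k, true) of its own, joined by an edge; each of
    them is tied to the point where the bar should end by an edge of length 0,
    or is a fixed vertex when the bar ends at a constant.  Each vertex v made
    so far is connected to a fixed root by a new vertex, its connector, at
    distance pi / 2 from both; as some point is orthogonal to two given ones,
    connectors impose no condition on v. *)
Section SystemLinkage.
Variables (R : realType) (d : nat).
Hypothesis d_ge2 : (2 <= d)%N.
Notation S := (spoint R d).
Variables (I : finType) (D : bar_system R d I).

Definition joint_vertex : Type := ((I + aux D) + (bar D * bool))%type.
(** The root is [None]; [Some (v, true)] is the connector of v. *)
Definition system_vertex : Type := option (joint_vertex * bool).

HB.instance Definition _ := Finite.on joint_vertex.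
HB.instance Definition _ := Finite.on system_vertex.

Definition root_vertex : system_vertex := None.
Definition connector (v : joint_vertex) : system_vertex := Some (v, true).
Definition point_vertex (i : I + aux D) : system_vertex := Some (inl i, false).
Definition end_vertex (k : bar D) (s : bool) : system_vertex := Some (inr (k, s), false).

Definition joint_link (v w : joint_vertex) : bool :=
  match v, w with
  | inl i, inr (k, s) => bar_end k s == inl i
  | inr (k, false), inr (k', true) => k == k'
  | _, _ => false
  end.

Definition link (a b : system_vertex) : bool :=
  match a with
  | None => false
  | Some (v, true) => b == None
  | Some (v, false) => match b with
    | None => false
    | Some (w, true) => v == w
    | Some (w, false) => joint_link v w
    end
  end.

(** Edges have to form a finite set, so they are given by a boolean [link], which
    orients them; proofs reason on its four cases instead. *)
Variant link_spec : system_vertex -> system_vertex -> Prop :=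
| LinkRoot v : link_spec (connector v) root_vertex
| LinkConnector v : link_spec (Some (v, false)) (connector v)
| LinkEnd i k s of bar_end k s = inl i : link_spec (point_vertex i) (end_vertex k s)
| LinkBar k : link_spec (end_vertex k false) (end_vertex k true).

Lemma linkP a b : link a b -> link_spec a b.
Proof.
case: a b => [[v []]|] [[w []]|] //= => [_|/eqP <-|].
- exact: LinkRoot.
- exact: LinkConnector.
case: v w => [i|[k []]] [j|[k' []]] //=.
- by move=> /eqP; exact: LinkEnd.
- by move=> /eqP; exact: LinkEnd.
- by move=> /eqP ->; exact: LinkBar.
Qed.

Lemma link_neq a b : link_spec a b -> a != b.
Proof. by move=> ab; apply/negP => /eqP; case: ab => // *; discriminate. Qed.

Definition system_edges : {set {set system_vertex}} :=
  [set E | [exists p : system_vertex * system_vertex,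
              link p.1 p.2 && (E == [set p.1; p.2]%SET)]]%SET.

Lemma link_edge a b : link a b -> [set a; b]%SET \in system_edges.
Proof. by move=> ab; rewrite inE; apply/existsP; exists (a, b); rewrite ab eqxx. Qed.

Lemma edge_link a b : [set a; b]%SET \in system_edges -> link_spec a b \/ link_spec b a.
Proof.
rewrite inE => /existsP[[u v] /andP[/linkP uv /eqP /= abuv]].
have : u \in [set a; b]%SET by rewrite abuv !inE eqxx.
have : v \in [set a; b]%SET by rewrite abuv !inE eqxx orbT.
have : a \in [set u; v]%SET by rewrite -abuv !inE eqxx.
have : b \in [set u; v]%SET by rewrite -abuv !inE eqxx orbT.
rewrite !inE => bE aE vE uE.
have neq := link_neq uv.
case/orP: aE bE uE vE => /eqP-> /orP[]/eqP->; rewrite ?eqxx ?orbF ?orbT ?orbb;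
  rewrite ?[v == u]eq_sym ?(negbTE neq)//; by [left|right].
Qed.

Lemma card_system_edge E : E \in system_edges -> #|E| = 2%N.
Proof.
rewrite inE => /existsP[[u v] /andP[/linkP uv /eqP /= ->]].
by rewrite cards2 (link_neq uv).
Qed.

Lemma system_connected v w :
  connect [rel x y | [set x; y]%SET \in system_edges] v w.
Proof.
set e := [rel x y | _]; have esym : symmetric e by move=> x y; rewrite /= finset.setUC.
have toroot u : connect e u root_vertex.
  case: u => [[u b]|]; last exact: connect0.
  have cr : connect e (connector u) root_vertex.
    apply: connect1; exact: (@link_edge (connector u) root_vertex isT).
  case: b => //; apply: connect_trans cr; apply: connect1.
  exact: (@link_edge (Some (u, false)) (connector u) (eqxx u)).
by apply: connect_trans (toroot v) _; rewrite sym_connect_sym.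
Qed.

(** The vertices in an edge tell its kind: only edges to connectors have length
    pi / 2, and among the other ones only the edges of length 0 contain a point
    of the system. *)
Definition system_len (E : {set system_vertex}) : R :=
  if [exists v, connector v \in E] then pi / 2
  else if [exists i, point_vertex i \in E] then 0
  else if [pick k | end_vertex k false \in E] is Some k then acos (bar_cos k) else 0.

Lemma system_len_ge0 E : 0 <= system_len E.
Proof.
rewrite /system_len; case: ifP => _; first by rewrite divr_ge0 ?pi_ge0.
case: ifP => // _; case: pickP => // k _; apply: acos_ge0; exact: bar_cos_itv.
Qed.

Definition system_fixed : {set system_vertex} :=
  [set v | match v with
           | None => true
           | Some (inr (k, s), false) => if bar_end k s is inr _ then true else false
           | _ => false
           end]%SET.

Lemma system_fixed_neq0 : system_fixed != finset.set0.
Proof. by apply/finset.set0Pn; exists root_vertex; rewrite inE. Qed.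

Definition north : 'rV[R]_d.+1 := delta_mx 0 0.

Lemma sphere_north : sphere north.
Proof.
rewrite /sphere /= /dotprod (bigD1 0)//= !mxE eqxx mulr1 big1 ?addr0// => j /negbTE j0.
by rewrite !mxE j0 andbF mulr0.
Qed.

Definition system_pos (v : system_vertex) : 'rV[R]_d.+1 :=
  if v is Some (inr (k, s), false) then
    if bar_end k s is inr p then val p else north
  else north.

Lemma system_pos_sphere v : v \in system_fixed -> sphere (system_pos v).
Proof.
move=> _; rewrite /system_pos; case: v => [[[i|[k s]] []]|]; try exact: sphere_north.
by case: (bar_end k s) => [_|p]; [exact: sphere_north|exact: spointP].
Qed.

Definition system_linkage : linkage R d :=
  @Linkage R d system_vertex system_edges card_system_edge system_connected
    system_len (fun E _ => system_len_ge0 E) system_fixed system_fixed_neq0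
    system_pos system_pos_sphere.

Lemma system_len_root v : system_len [set connector v; root_vertex]%SET = pi / 2.
Proof. by rewrite /system_len ifT//; apply/existsP; exists v; rewrite !inE eqxx. Qed.

Lemma system_len_connector v : system_len [set Some (v, false); connector v]%SET = pi / 2.
Proof. by rewrite /system_len ifT//; apply/existsP; exists v; rewrite !inE eqxx orbT. Qed.

Lemma system_len_end i k s : system_len [set point_vertex i; end_vertex k s]%SET = 0.
Proof.
rewrite /system_len ifF; last by apply/existsP => -[v]; rewrite !inE => /orP[]/eqP.
by rewrite ifT//; apply/existsP; exists i; rewrite !inE eqxx.
Qed.

Lemma system_len_bar k :
  system_len [set end_vertex k false; end_vertex k true]%SET = acos (bar_cos k).
Proof.
rewrite /system_len ifF; last by apply/existsP => -[v]; rewrite !inE => /orP[]/eqP.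
rewrite ifF; last by apply/existsP => -[v]; rewrite !inE => /orP[]/eqP.
case: pickP => [k'|/(_ k)]; last by rewrite !inE eqxx.
by rewrite !inE => /orP[]/eqP // [->].
Qed.

Lemma realization_satisfies (phi : system_vertex -> 'rV[R]_d.+1)
    (x : I -> S) (y : aux D -> S) :
  @realization R d system_linkage phi ->
  (forall i, phi (point_vertex i) = val (joint x y i)) -> satisfies x y.
Proof.
move=> [phiS phifix philen] xy.
have endE k s : phi (end_vertex k s) = val (endpoint x y (bar_end k s)).
  case ks: (bar_end k s) => [i|p].
    rewrite /= -xy; apply/esym/geodist_eq0 => //.
    rewrite philen; first exact: system_len_end.
    by apply: link_edge; apply/eqP.
  have fixE : end_vertex k s \in system_fixed by rewrite inE /= ks.
  by rewrite (phifix _ fixE) /= ks.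
move=> k; rewrite -!endE; apply: geodist_acos => //; first exact: bar_cos_itv.
by rewrite philen; [exact: system_len_bar|apply: link_edge; exact: eqxx].
Qed.

Lemma satisfies_realization (x : I -> S) (y : aux D -> S) : satisfies x y ->
  exists2 phi : system_vertex -> 'rV[R]_d.+1, @realization R d system_linkage phi &
    forall i, phi (point_vertex i) = val (joint x y i).
Proof.
move=> xy.
pose pos (v : joint_vertex) : 'rV[R]_d.+1 := match v with
  | inl i => val (joint x y i)
  | inr (k, s) => val (endpoint x y (bar_end k s)) end.
have posS v : sphere (pos v) by case: v => [i|[k s]]; exact: spointP.
have /boolp.choice[mid midP] : forall v, exists z, [/\ sphere z,
  dotprod z (pos v) = 0 & dotprod z north = 0] := fun v => exists_orthogonal _ _ d_ge2.
pose phi (v : system_vertex) := match v with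
  | None => north | Some (v, false) => pos v | Some (v, true) => mid v end.
exists phi => //; split.
- by move=> [[v []]|] /=; [have [] := midP v|exact: posS|exact: sphere_north].
- move=> [[[i|[k s]] []]|]; rewrite inE //= /system_pos.
  by case: bar_end.
- suff len_phi a b : link_spec a b -> geodist (phi a) (phi b) = system_len [set a; b]%SET.
    by move=> a b /edge_link[/len_phi//|/len_phi]; rewrite geodistC finset.setUC.
  case=> [v|v|i k s ks|k].
  + by rewrite system_len_root /geodist; have [_ _ ->] := midP v; rewrite acos0.
  + by rewrite system_len_connector geodistC /geodist; have [_ -> _] := midP v; rewrite acos0.
  + rewrite system_len_end -[phi (end_vertex k s)]/(val (endpoint x y (bar_end k s))) ks.
    by rewrite /geodist (spointP (joint x y i)) acos1.
  + by rewrite system_len_bar /geodist /=; congr acos; exact: xy.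
Qed.

End SystemLinkage.

Lemma definable_linkage (R : realType) (d n : nat) (P : ('I_n -> spoint R d) -> Prop) :
  (2 <= d)%N -> definable P ->
  exists (L : linkage R d) (W : {set vertex L}) (w : 'I_n -> {v : vertex L | v \in W}),
    bijective w /\ [set \matrix_(i < n) psi (w i) | psi in conf L W] =
                   [set \matrix_(i < n) val (x i) | x in P].
Proof.
move=> d2 [D PD]; pose v i : vertex (system_linkage D) := point_vertex (D := D) (inl i).
have v_inj : injective v by move=> i j [].
pose W := [set v i | i in 'I_n]%SET.
have vW i : v i \in W by exact: imset_f.
exists (system_linkage D), W, (fun i => exist _ (v i) (vW i)); split.
  apply: inj_card_bij; first by move=> i j /(congr1 val) /v_inj.
  by rewrite card_sig (card_imset _ v_inj).
apply/seteqP; split=> X.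
  move=> [psi [phi phiR psiE] XE]; rewrite -XE -psiE {psi psiE XE X}.
  have [phiS _ _] := phiR.
  pose pt u : spoint R d := exist _ (phi u) (introT eqP (phiS u)).
  exists (fun i => pt (v i)) => //; apply/PD.
  exists (fun j => pt (point_vertex (inr j))).
  by apply: realization_satisfies phiR _ => -[].
move=> [x /PD[y /(satisfies_realization d2)[phi phiR phix]] <-].
exists (fun u => phi (val u)); first by exists phi.
by apply/matrixP => i j; rewrite !mxE phix.
Qed.

(** * Half-spaces and cross products *)

Section Gadgets.
Variables (R : realType) (d : nat).
Hypothesis d_ge2 : (2 <= d)%N.
Notation S := (spoint R d).
Notation basis j := (delta_mx 0 j : 'rV[R]_d.+1).

Definition spoint_of (v : 'rV[R]_d.+1) (vS : sphere v) : S := exist _ v (introT eqP vS).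

Lemma dotprod_basis (v : 'rV[R]_d.+1) j : dotprod v (basis j) = v 0 j.
Proof.
rewrite /dotprod (bigD1 j)//= !mxE !eqxx mulr1 big1 ?addr0// => k /negbTE kj.
by rewrite !mxE kj andbF mulr0.
Qed.

Lemma sphere_basis j : sphere (basis j).
Proof. by rewrite /sphere /= dotprod_basis mxE !eqxx. Qed.

Definition axis j : S := spoint_of (sphere_basis j).

Lemma definable_true I : @definable R d I (fun=> True).
Proof.
apply: (@definable_iff _ _ _ _ (fun _ => forall v : void, False)) => [x|].
  by split=> // _ [].
by apply: definable_forall => -[].
Qed.

Lemma definable_imply I (b : bool) (P : (I -> S) -> Prop) :
  definable P -> definable (fun x => b -> P x).
Proof.
case: b => dP; last by apply: definable_iff (definable_true I) => x; split.
by apply: definable_iff dP => x; split=> [|//]; apply.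
Qed.

Lemma definable_orthogonal I (a b : (I -> S) -> S) : is_term a -> is_term b ->
  definable (fun x => dotprod (val (a x)) (val (b x)) = 0).
Proof. by move=> ta tb; apply: definable_dotprod => //; rewrite oppr_le0 ler01. Qed.

Lemma definable_coord0 I (a : (I -> S) -> S) j : is_term a ->
  definable (fun x => (val (a x)) 0 j = 0).
Proof.
move=> ta; apply: definable_iff (definable_orthogonal ta (is_term_const I (axis j))).
by move=> x; rewrite dotprod_basis.
Qed.

(** Points p and q at distance at most pi / 2 are those that have a common
    neighbour z at distance pi / 4.  For <p, q> = g >= 0, such a z is the sum of
    a multiple of p + q and of a vector orthogonal to p and q; conversely, with
    c = cos (pi / 4), the squared norm of p + q - 2 c z is 2 g. *)
Lemma nonneg_dotprodP (p q : S) (c := (Num.sqrt 2)^-1 : R) :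
  0 <= dotprod (val p) (val q) <->
  exists z : S, dotprod (val z) (val p) = c /\ dotprod (val z) (val q) = c.
Proof.
have c2 : c ^+ 2 = 2^-1 by rewrite exprVn sqr_sqrtr.
have p1 : dotprod (val p) (val p) = 1 := spointP p.
have q1 : dotprod (val q) (val q) = 1 := spointP q.
set g := dotprod (val p) (val q); have qp : dotprod (val q) (val p) = g by rewrite dotprodC.
split=> [g0|[z [zp zq]]].
  have [w [w1 wp wq]] := exists_orthogonal (val p) (val q) d_ge2.
  pose a := c / (1 + g); pose b := Num.sqrt (g / (1 + g)).
  have g1 : 1 + g != 0 by rewrite gt_eqF//; lra.
  have b2 : b ^+ 2 = g / (1 + g) by rewrite sqr_sqrtr// divr_ge0//; lra.
  pose z := a *: (val p + val q) + b *: w.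
  have pw : dotprod (val p) w = 0 by rewrite dotprodC.
  have qw : dotprod (val q) w = 0 by rewrite dotprodC.
  have zS : sphere z.
    rewrite /sphere /= !(dotprodDl, dotprodDr, dotprodZl, dotprodZr).
    rewrite wp wq pw qw p1 q1 qp -/g (w1 : dotprod w w = 1).
    transitivity (c ^+ 2 * 2 / (1 + g) + b ^+ 2); first by rewrite /a; field.
    by rewrite c2 b2; field.
  exists (spoint_of zS).
  rewrite /= !(dotprodDl, dotprodZl) wp wq p1 q1 qp -/g.
  by split; rewrite /a; field.
have z1 : dotprod (val z) (val z) = 1 := spointP z.
have := dotprod_ge0 (val p + val q + - (2 * c) *: val z).
rewrite !(dotprodDl, dotprodDr, dotprodZl, dotprodZr).
rewrite !(dotprodC _ (val z)) zp zq z1 p1 q1 qp -/g => H.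
have : 0 <= 2 + 2 * g - 4 * c ^+ 2.
  by apply: le_trans H _; rewrite le_eqVlt; apply/orP; left; apply/eqP; ring.
by rewrite c2; lra.
Qed.

Lemma definable_nonneg I (a b : (I -> S) -> S) : is_term a -> is_term b ->
  definable (fun x => 0 <= dotprod (val (a x)) (val (b x))).
Proof.
move=> ta tb; apply: definable_iff (fun x => nonneg_dotprodP (a x) (b x)) _.
pose c : R := (Num.sqrt 2)^-1; have c1 : -1 <= c <= 1.
  have s1 : 1 <= Num.sqrt 2 :> R by rewrite -[leLHS]sqrtr1 ler_wsqrtr// ler1n.
  have s0 : 0 < Num.sqrt 2 :> R by rewrite (lt_le_trans ltr01).
  apply/andP; split; last by rewrite -[leRHS]invr1 lef_pV2// posrE.
  by apply: (@le_trans _ _ 0); [rewrite oppr_le0|rewrite invr_ge0 ltW].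
apply: definable_exists1; apply: definable_and.
  by apply: definable_dotprod c1; [exact: is_term_var|exact: is_term_comp].
by apply: definable_dotprod c1; [exact: is_term_var|exact: is_term_comp].
Qed.

Definition vec3 (k l m : 'I_d.+1) (a b c : R) : 'rV[R]_d.+1 :=
  a *: basis k + b *: basis l + c *: basis m.

Lemma dotprod_vec3 (y : 'rV[R]_d.+1) k l m a b c :
  dotprod y (vec3 k l m a b c) = a * y 0 k + b * y 0 l + c * y 0 m.
Proof. by rewrite !dotprodDr !dotprodZr !dotprod_basis. Qed.

Definition in_frame k l m (y : 'rV[R]_d.+1) :=
  forall j, j \notin [:: k; l; m] -> y 0 j = 0.

Lemma definable_in_frame I (a : (I -> S) -> S) k l m : is_term a ->
  definable (fun x => in_frame k l m (val (a x))).
Proof. by move=> ta; apply: definable_forall => j; exact/definable_imply/definable_coord0. Qed.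

Lemma vec3_coords k l m a b c (v := vec3 k l m a b c) : uniq [:: k; l; m] ->
  [/\ v 0 k = a, v 0 l = b, v 0 m = c & in_frame k l m v].
Proof.
rewrite /= !inE negb_or andbT => /andP[/andP[/negbTE kl /negbTE km] /negbTE lm].
have vE j : v 0 j = a *+ (j == k) + b *+ (j == l) + c *+ (j == m).
  by rewrite !mxE !eqxx /= !mulr_natr.
rewrite !vE !eqxx kl km lm (eq_sym l) kl !(eq_sym m) km lm !mulr0n !addr0 !add0r.
split=> // j; rewrite !inE !negb_or => /and3P[/negbTE jk /negbTE jl /negbTE jm].
by rewrite vE jk jl jm !addr0.
Qed.

Lemma in_frame_vec3 k l m y : uniq [:: k; l; m] -> in_frame k l m y ->
  y = vec3 k l m (y 0 k) (y 0 l) (y 0 m).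
Proof.
move=> klm yf; apply/rowP => j.
have [vk vl vm vf] := vec3_coords (y 0 k) (y 0 l) (y 0 m) klm.
have [|jf] := boolP (j \in [:: k; l; m]); last by rewrite yf ?vf.
by rewrite !inE => /or3P[]/eqP->.
Qed.

Lemma scale_vec3 r k l m a b c :
  r *: vec3 k l m a b c = vec3 k l m (r * a) (r * b) (r * c).
Proof. by rewrite !scalerDr !scalerA. Qed.

Definition parallel (y v : 'rV[R]_d.+1) := exists r, y = r *: v.

(** In the space spanned by three basis vectors, the vectors orthogonal to v and
    w are the multiples of their cross product, if it is nonzero.  The factor s
    allows the cross product to be given up to a scalar. *)
Lemma parallel_cross k l m (y : 'rV[R]_d.+1) a1 b1 c1 a2 b2 c2 a b c s :
  uniq [:: k; l; m] -> s != 0 -> ~~ [&& a == 0, b == 0 & c == 0] ->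
  b1 * c2 - c1 * b2 = s * a -> c1 * a2 - a1 * c2 = s * b -> a1 * b2 - b1 * a2 = s * c ->
  parallel y (vec3 k l m a b c) <->
  [/\ in_frame k l m y, dotprod y (vec3 k l m a1 b1 c1) = 0 &
      dotprod y (vec3 k l m a2 b2 c2) = 0].
Proof.
move=> klm s0 abc0 ea eb ec.
have sI x : s * x = 0 -> x = 0.
  by move=> /eqP; rewrite mulf_eq0 (negbTE s0) /= => /eqP.
rewrite !dotprod_vec3; split=> [[r ->]|[yf y1 y2]].
  rewrite scale_vec3.
  have [-> -> -> vf] := vec3_coords (r * a) (r * b) (r * c) klm.
  split=> //; apply: sI.
    transitivity (r * (a1 * (s * a) + b1 * (s * b) + c1 * (s * c))); first by ring.
    by rewrite -ea -eb -ec; ring.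
  transitivity (r * (a2 * (s * a) + b2 * (s * b) + c2 * (s * c))); first by ring.
  by rewrite -ea -eb -ec; ring.
(* y is orthogonal to v and w, so its cross product with v x w vanishes *)
have e1 : y 0 k * b = y 0 l * a.
  apply/eqP; rewrite -subr_eq0; apply/eqP/sI.
  transitivity (y 0 k * (s * b) - y 0 l * (s * a)); first by ring.
  rewrite -ea -eb.
  transitivity (c1 * (a2 * y 0 k + b2 * y 0 l + c2 * y 0 m) -
    c2 * (a1 * y 0 k + b1 * y 0 l + c1 * y 0 m)); first by ring.
  by rewrite y1 y2 !mulr0 subrr.
have e2 : y 0 l * c = y 0 m * b.
  apply/eqP; rewrite -subr_eq0; apply/eqP/sI.
  transitivity (y 0 l * (s * c) - y 0 m * (s * b)); first by ring.
  rewrite -ec -eb.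
  transitivity (a1 * (a2 * y 0 k + b2 * y 0 l + c2 * y 0 m) -
    a2 * (a1 * y 0 k + b1 * y 0 l + c1 * y 0 m)); first by ring.
  by rewrite y1 y2 !mulr0 subrr.
have e3 : y 0 m * a = y 0 k * c.
  apply/eqP; rewrite -subr_eq0; apply/eqP/sI.
  transitivity (y 0 m * (s * a) - y 0 k * (s * c)); first by ring.
  rewrite -ec -ea.
  transitivity (b1 * (a2 * y 0 k + b2 * y 0 l + c2 * y 0 m) -
    b2 * (a1 * y 0 k + b1 * y 0 l + c1 * y 0 m)); first by ring.
  by rewrite y1 y2 !mulr0 subrr.
suff [r [ra rb rc]] : exists r, [/\ y 0 k = r * a, y 0 l = r * b & y 0 m = r * c].
  by exists r; rewrite (in_frame_vec3 klm yf) ra rb rc scale_vec3.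
have [a0|aN0] := eqVneq a 0; last first.
  exists (y 0 k / a); split; first by rewrite divfK.
    by rewrite mulrAC e1 mulfK.
  by rewrite mulrAC -e3 mulfK.
have [b0|bN0] := eqVneq b 0; last first.
  exists (y 0 l / b); split; first by rewrite mulrAC -e1 mulfK.
    by rewrite divfK.
  by rewrite mulrAC e2 mulfK.
have cN0 : c != 0 by move: abc0; rewrite a0 b0 eqxx.
exists (y 0 m / c); split; first by rewrite mulrAC e3 mulfK.
  by rewrite mulrAC -e2 mulfK.
by rewrite divfK.
Qed.

End Gadgets.

(** * Computing with directions *)

Section Directions.
Variables (R : realType) (d : nat) (N : Type).
Notation S := (spoint R d).
Notation basis j := (delta_mx 0 j : 'rV[R]_d.+1).

Definition vec2 (k l : 'I_d.+1) (a : R) : 'rV[R]_d.+1 := basis k + a *: basis l.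

Lemma vec2_neq0 k l a : k != l -> vec2 k l a != 0.
Proof.
move=> kl; apply/eqP => /matrixP/(_ 0 k)/eqP.
by rewrite !mxE !eqxx (negbTE kl) mulr0 addr0 oner_eq0.
Qed.

Variables (o0 o1 o2 : 'I_d.+1).
Hypothesis o_uniq : uniq [:: o0; o1; o2].

Fact o01 : o0 != o1.
Proof. by move: o_uniq; rewrite /= !inE negb_or => /andP[/andP[]]. Qed.

(** The number a is the slope of the line through [encode a] in the plane of two
    basis vectors. *)
Definition encode (a : R) : S := spoint_of (sphere_normalize (vec2_neq0 a o01)).

(** Orthogonality only sees lines.  A vector v depending on numbers is traceable
    if a definable relation on their codes finds a unit vector on the line of v,
    possibly only one of the two, and constructible if it finds both. *)
Definition traceable (v : (N -> R) -> 'rV[R]_d.+1) : Prop :=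
  exists T : (N -> S) -> S -> Prop,
    definable (fun z : N + unit -> S => T (z \o inl) (z (inr tt))) /\
    forall t, (exists y, T (encode \o t) y) /\
              forall y, T (encode \o t) y -> parallel (val y) (v t).

Definition constructible (v : (N -> R) -> 'rV[R]_d.+1) : Prop :=
  exists T : (N -> S) -> S -> Prop,
    definable (fun z : N + unit -> S => T (z \o inl) (z (inr tt))) /\
    forall t y, T (encode \o t) y <-> parallel (val y) (v t).

Lemma definable_subst I (T : (N -> S) -> S -> Prop) (h : N -> I) (a : I) :
  definable (fun z : N + unit -> S => T (z \o inl) (z (inr tt))) ->
  definable (fun z : I -> S => T (z \o h) (z a)).
Proof. exact: (definable_comp (joint h (fun=> a))). Qed.

Lemma parallel_normalize (v : 'rV[R]_d.+1) : parallel (normalize v) v.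
Proof. by eexists. Qed.

Lemma constructible_traceable v : (forall t, v t != 0) -> constructible v -> traceable v.
Proof.
move=> v0 [T [dT TP]]; exists T; split=> // t; split=> [|y /TP//].
by exists (spoint_of (sphere_normalize (v0 t))); apply/TP/parallel_normalize.
Qed.

Lemma traceable_scale r v w : (forall t, v t = r *: w t) -> traceable v -> traceable w.
Proof.
move=> vw [T [dT TP]]; exists T; split=> // t; have [ex par] := TP t; split=> // y.
by move=> /par[a ->]; exists (a * r); rewrite vw scalerA.
Qed.

Lemma traceable_const (v : 'rV[R]_d.+1) : v != 0 -> traceable (fun=> v).
Proof.
move=> v0; pose p : S := spoint_of (sphere_normalize v0).
exists (fun _ y => dotprod (val y) (val p) = 1); split=> [|t].
  apply: definable_dotprod; [exact: is_term_var|exact: is_term_const|].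
  by rewrite lexx andbT (le_trans _ ler01)// oppr_le0.
split=> [|y]; first by exists p; exact: spointP.
by move=> /(sphere_dotprod1 (spointP y) (spointP p)) ->; exact: parallel_normalize.
Qed.

Lemma traceable_var n : traceable (fun t => vec2 o0 o1 (t n)).
Proof.
exists (fun x y => dotprod (val y) (val (x n)) = 1); split=> [|t].
  apply: definable_dotprod; [exact: is_term_var|exact: (@is_term_var R d (N + unit)%type (inl n))|].
  by rewrite lexx andbT (le_trans _ ler01)// oppr_le0.
split=> [|y]; first by exists (encode (t n)); exact: spointP.
move=> /(sphere_dotprod1 (spointP y) (spointP _)) ->; exact: parallel_normalize.
Qed.

Lemma parallel_orthogonal (y y' v : 'rV[R]_d.+1) : sphere y -> parallel y v ->
  dotprod y' y = 0 <-> dotprod y' v = 0.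
Proof.
move=> y1 [r yr]; rewrite yr dotprodZr; split=> [/eqP|->]; last by rewrite mulr0.
rewrite mulf_eq0 => /orP[/eqP r0|/eqP//].
have /eqP y0 : dotprod y y == 0 by rewrite dotprod_eq0 yr r0 scale0r.
by move: y1; rewrite /sphere /= y0 => /eqP; rewrite eq_sym oner_eq0.
Qed.

(** A unit vector on the line of a cross product is found by its orthogonality to
    the two factors and to the basis vectors outside the frame; these conditions
    do not distinguish opposite vectors. *)
Lemma constructible_cross k l m s (a1 b1 c1 a2 b2 c2 a b c : (N -> R) -> R) :
  uniq [:: k; l; m] -> s != 0 ->
  traceable (fun t => vec3 k l m (a1 t) (b1 t) (c1 t)) ->
  traceable (fun t => vec3 k l m (a2 t) (b2 t) (c2 t)) ->
  (forall t, [/\ ~~ [&& a t == 0, b t == 0 & c t == 0],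
     b1 t * c2 t - c1 t * b2 t = s * a t, c1 t * a2 t - a1 t * c2 t = s * b t &
     a1 t * b2 t - b1 t * a2 t = s * c t]) ->
  constructible (fun t => vec3 k l m (a t) (b t) (c t)).
Proof.
move=> klm s0 [T1 [dT1 T1P]] [T2 [dT2 T2P]] cross.
exists (fun x y => in_frame k l m (val y) /\ exists y1, exists y2,
  (T1 x y1 /\ T2 x y2) /\
  (dotprod (val y) (val y1) = 0 /\ dotprod (val y) (val y2) = 0)); split=> [|t y].
  apply: definable_and; first exact/definable_in_frame/is_term_var.
  apply: definable_exists1; apply: definable_exists1; apply: definable_and.
    apply: definable_and.
      exact: (@definable_subst _ T1 (fun n => inl (inl (inl n))) (inl (inr tt)) dT1).
    exact: (@definable_subst _ T2 (fun n => inl (inl (inl n))) (inr tt) dT2).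
  by apply: definable_and; apply: definable_orthogonal; exact: is_term_var.
have [abc0 ea eb ec] := cross t.
rewrite (parallel_cross _ klm s0 abc0 ea eb ec).
have [[y1 Ty1] T1par] := T1P t; have [[y2 Ty2] T2par] := T2P t.
split=> [[yf [u1 [u2 [[/T1par p1 /T2par p2] [yu1 yu2]]]]]|[yf yv1 yv2]].
  split=> //; first exact/(parallel_orthogonal _ (spointP u1) p1).
  exact/(parallel_orthogonal _ (spointP u2) p2).
split=> //; exists y1, y2; split=> //; split.
  exact/(parallel_orthogonal _ (spointP y1) (T1par _ Ty1)).
exact/(parallel_orthogonal _ (spointP y2) (T2par _ Ty2)).
Qed.

Lemma vec3_neq0 k l m a b c : uniq [:: k; l; m] ->
  ~~ [&& a == 0, b == 0 & c == 0] -> vec3 k l m a b c != 0 :> 'rV[R]_d.+1.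
Proof.
move=> klm; apply: contraNneq => v0; have [] := vec3_coords a b c klm.
by rewrite v0 !mxE => <- <- <- _; rewrite eqxx.
Qed.

Lemma traceable_cross k l m s (a1 b1 c1 a2 b2 c2 a b c : (N -> R) -> R) :
  uniq [:: k; l; m] -> s != 0 ->
  traceable (fun t => vec3 k l m (a1 t) (b1 t) (c1 t)) ->
  traceable (fun t => vec3 k l m (a2 t) (b2 t) (c2 t)) ->
  (forall t, [/\ ~~ [&& a t == 0, b t == 0 & c t == 0],
     b1 t * c2 t - c1 t * b2 t = s * a t, c1 t * a2 t - a1 t * c2 t = s * b t &
     a1 t * b2 t - b1 t * a2 t = s * c t]) ->
  traceable (fun t => vec3 k l m (a t) (b t) (c t)).
Proof.
move=> klm s0 tr1 tr2 cross; apply: constructible_traceable.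
  by move=> t; apply: vec3_neq0 => //; have [] := cross t.
exact: constructible_cross klm s0 tr1 tr2 cross.
Qed.

Lemma traceable_cross_const k l m s a2 b2 c2 (a1 b1 c1 a b c : (N -> R) -> R) :
  uniq [:: k; l; m] -> s != 0 -> ~~ [&& a2 == 0, b2 == 0 & c2 == 0] ->
  (forall t, [/\ ~~ [&& a t == 0, b t == 0 & c t == 0],
     b1 t * c2 - c1 t * b2 = s * a t, c1 t * a2 - a1 t * c2 = s * b t &
     a1 t * b2 - b1 t * a2 = s * c t]) ->
  traceable (fun t => vec3 k l m (a1 t) (b1 t) (c1 t)) ->
  traceable (fun t => vec3 k l m (a t) (b t) (c t)).
Proof.
move=> klm s0 v0 cross tr; apply: (traceable_cross klm s0 tr _ cross).
exact/traceable_const/vec3_neq0.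
Qed.

Lemma vec3_vec2 k l m a :
  (vec3 k l m 1 a 0 = vec2 k l a) * (vec3 k l m 1 0 a = vec2 k m a) *
  (vec3 k l m 0 a 1 = vec2 m l a).
Proof.
by rewrite /vec3 /vec2 !scale1r !scale0r !addr0 add0r [_ + basis m]addrC.
Qed.

(** Checks a cross product; a coordinate equal to 1 or -1 shows that it is nonzero. *)
Ltac cross_step := move=> t; split; [
  rewrite ?oner_eq0 ?oppr_eq0 ?oner_eq0 ?andbF //= | ring ..].

(** In coordinates: (1, f, 0) x (0, 1, -1) = (-f, 1, 1), whose product with
    (0, 1, 0) is -(1, 0, f). *)
Lemma traceable_shift k l m f : uniq [:: k; l; m] ->
  traceable (fun t => vec2 k l (f t)) -> traceable (fun t => vec2 k m (f t)).
Proof.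
move=> klm tr; have tr1 : traceable (fun t => vec3 k l m 1 (f t) 0).
  by apply: (traceable_scale (r := 1) _ tr) => t; rewrite vec3_vec2 scale1r.
have tr2 : traceable (fun t => vec3 k l m (- f t) 1 1).
  by apply: (traceable_cross_const (s := 1) (a2 := 0) (b2 := 1) (c2 := -1) klm _ _ _ tr1);
   rewrite ?oner_eq0 ?andbF//; cross_step.
have tr3 : traceable (fun t => vec3 k l m 1 0 (f t)).
  by apply: (traceable_cross_const (s := -1) (a2 := 0) (b2 := 1) (c2 := 0) klm _ _ _ tr2);
   rewrite ?oppr_eq0 ?oner_eq0 ?andbF//; cross_step.
by apply: (traceable_scale (r := 1) _ tr3) => t; rewrite vec3_vec2 scale1r.
Qed.

(** In coordinates: (0, f, 1) x (-1, 0, 1) = (f, -1, f), whose product with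
    (0, 0, 1) is -(1, f, 0). *)
Lemma traceable_replace k l m f : uniq [:: k; l; m] ->
  traceable (fun t => vec2 m l (f t)) -> traceable (fun t => vec2 k l (f t)).
Proof.
move=> klm tr; have tr1 : traceable (fun t => vec3 k l m 0 (f t) 1).
  by apply: (traceable_scale (r := 1) _ tr) => t; rewrite vec3_vec2 scale1r.
have tr2 : traceable (fun t => vec3 k l m (f t) (-1) (f t)).
  by apply: (traceable_cross_const (s := 1) (a2 := -1) (b2 := 0) (c2 := 1) klm _ _ _ tr1);
   rewrite ?oner_eq0 ?andbF//; cross_step.
have tr3 : traceable (fun t => vec3 k l m 1 (f t) 0).
  by apply: (traceable_cross_const (s := -1) (a2 := 0) (b2 := 0) (c2 := 1) klm _ _ _ tr2);
   rewrite ?oppr_eq0 ?oner_eq0 ?andbF//; cross_step.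
by apply: (traceable_scale (r := 1) _ tr3) => t; rewrite vec3_vec2 scale1r.
Qed.

(** The vector (f, -1, 0) is orthogonal to (1, f, 0) in the same plane; taking the
    orthogonal direction twice yields both unit vectors on the first line. *)
Lemma traceable_swap k l m f : uniq [:: k; l; m] ->
  traceable (fun t => vec2 k l (f t)) ->
  constructible (fun t => vec2 k l (f t)) /\
  traceable (fun t => vec3 k l m (f t) (-1) 0).
Proof.
move=> klm tr; have tr1 : traceable (fun t => vec3 k l m 1 (f t) 0).
  by apply: (traceable_scale (r := 1) _ tr) => t; rewrite vec3_vec2 scale1r.
have tr2 : traceable (fun t => vec3 k l m (f t) (-1) 0).
  by apply: (traceable_cross_const (s := 1) (a2 := 0) (b2 := 0) (c2 := 1) klm _ _ _ tr1);
   rewrite ?oner_eq0 ?andbF//; cross_step.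
split=> //; rewrite (_ : (fun t => _) = (fun t => vec3 k l m 1 (f t) 0)); last first.
  by apply/funext => t; rewrite vec3_vec2.
have v0 : vec3 k l m 0 0 1 != 0 :> 'rV[R]_d.+1 by rewrite vec3_neq0// oner_eq0 !andbF.
by apply: (constructible_cross (s := -1) klm _ tr2 (traceable_const v0));
  rewrite ?oppr_eq0 ?oner_eq0//; cross_step.
Qed.

(** (1, f, g) is orthogonal to (f, -1, 0) and to (-g, 0, 1). *)
Lemma traceable_pair k l m f g : uniq [:: k; l; m] ->
  traceable (fun t => vec2 k l (f t)) -> traceable (fun t => vec2 k m (g t)) ->
  traceable (fun t => vec3 k l m 1 (f t) (g t)).
Proof.
move=> klm trf trg; have [_ tr1] := traceable_swap klm trf.
have tr2 : traceable (fun t => vec3 k l m 1 0 (g t)).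
  by apply: (traceable_scale (r := 1) _ trg) => t; rewrite vec3_vec2 scale1r.
have tr3 : traceable (fun t => vec3 k l m (- g t) 0 1).
  by apply: (traceable_cross_const (s := 1) (a2 := 0) (b2 := 1) (c2 := 0) klm _ _ _ tr2);
   rewrite ?oner_eq0 ?andbF//; cross_step.
by apply: (traceable_cross (s := -1) klm _ tr1 tr3); rewrite ?oppr_eq0 ?oner_eq0//; cross_step.
Qed.

Definition computable (f : (N -> R) -> R) := traceable (fun t => vec2 o0 o1 (f t)).

Lemma o_uniq_rot : uniq [:: o0; o2; o1].
Proof.
move: o_uniq; rewrite /= !inE !negb_or (eq_sym o2) => /andP[/andP[n01 n02] /andP[n12 _]].
by rewrite n01 n02 n12.
Qed.

(** (f, -1, fg) is orthogonal to (1, f, 0) and to (-g, 0, 1); its cross product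
    with the first basis vector is (0, fg, 1). *)
Lemma computable_mul f g : computable f -> computable g ->
  computable (fun t => f t * g t).
Proof.
move=> cf cg; have tr0 : traceable (fun t => vec3 o0 o1 o2 1 (f t) 0).
  by apply: (traceable_scale (r := 1) _ cf) => t; rewrite vec3_vec2 scale1r.
have tr2 : traceable (fun t => vec3 o0 o1 o2 1 0 (g t)).
  apply: (traceable_scale (r := 1) _ (traceable_shift o_uniq cg)) => t.
  by rewrite vec3_vec2 scale1r.
have tr3 : traceable (fun t => vec3 o0 o1 o2 (- g t) 0 1).
  by apply: (traceable_cross_const (s := 1) (a2 := 0) (b2 := 1) (c2 := 0) o_uniq _ _ _ tr2);
   rewrite ?oner_eq0 ?andbF//; cross_step.
have tr4 : traceable (fun t => vec3 o0 o1 o2 (f t) (-1) (f t * g t)).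
  by apply: (traceable_cross (s := 1) o_uniq _ tr0 tr3); rewrite ?oner_eq0//; cross_step.
have tr5 : traceable (fun t => vec3 o0 o1 o2 0 (f t * g t) 1).
  by apply: (traceable_cross_const (s := 1) (a2 := 1) (b2 := 0) (c2 := 0) o_uniq _ _ _ tr4);
   rewrite ?oner_eq0 ?andbF//; cross_step.
apply: (traceable_replace o_uniq).
by apply: (traceable_scale (r := 1) _ tr5) => t; rewrite vec3_vec2 scale1r.
Qed.

(** -(1, f, f - g) is orthogonal to (f, -1, 0) and to (g, -1, 1), which in turn is
    the cross product of (1, g, 0) and (0, 1, 1); its second coordinate is then
    projected away. *)
Lemma computable_sub f g : computable f -> computable g ->
  computable (fun t => f t - g t).
Proof.
move=> cf cg; have tr0 : traceable (fun t => vec3 o0 o1 o2 1 (g t) 0).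
  by apply: (traceable_scale (r := 1) _ cg) => t; rewrite vec3_vec2 scale1r.
have [_ tr1] := traceable_swap o_uniq cf.
have tr2 : traceable (fun t => vec3 o0 o1 o2 (g t) (-1) 1).
  by apply: (traceable_cross_const (s := 1) (a2 := 0) (b2 := 1) (c2 := 1) o_uniq _ _ _ tr0);
   rewrite ?oner_eq0 ?andbF//; cross_step.
have tr3 : traceable (fun t => vec3 o0 o1 o2 (-1) (- f t) (g t - f t)).
  by apply: (traceable_cross (s := 1) o_uniq _ tr1 tr2); rewrite ?oner_eq0//; cross_step.
have tr4 : traceable (fun t => vec3 o0 o1 o2 (f t - g t) 0 (-1)).
  by apply: (traceable_cross_const (s := 1) (a2 := 0) (b2 := 1) (c2 := 0) o_uniq _ _ _ tr3);
   rewrite ?oner_eq0 ?andbF//; cross_step.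
have tr5 : traceable (fun t => vec3 o0 o1 o2 1 0 (f t - g t)).
  by apply: (traceable_cross_const (s := 1) (a2 := 0) (b2 := 1) (c2 := 0) o_uniq _ _ _ tr4);
   rewrite ?oner_eq0 ?andbF//; cross_step.
apply: (traceable_shift o_uniq_rot).
by apply: (traceable_scale (r := 1) _ tr5) => t; rewrite vec3_vec2 scale1r.
Qed.

Lemma computable_const c : computable (fun=> c).
Proof. exact/traceable_const/vec2_neq0/o01. Qed.

Lemma polyfun_computable (f : (N -> R) -> R) : polyfun f -> computable f.
Proof.
elim=> {f} [c|n|f g _ cf _ cg|f g _ cf _ cg].
- exact: computable_const.
- exact: traceable_var.
- have cf' := computable_sub cf (computable_sub (computable_const 0) cg).
  by apply: (traceable_scale (r := 1) _ cf') => t; rewrite scale1r sub0r opprK.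
- exact: computable_mul.
Qed.

Lemma polyfun_zero_definable (f : (N -> R) -> R) : polyfun f ->
  exists2 Z : (N -> S) -> Prop, definable Z & forall t, Z (encode \o t) <-> f t = 0.
Proof.
move=> /polyfun_computable[T [dT TP]].
exists (fun x => exists y, T x y /\ (val y) 0 o1 = 0) => [|t].
  apply: definable_exists1; apply: definable_and => //.
  exact/definable_coord0/is_term_var.
have o10 : vec2 o0 o1 (f t) 0 o1 = f t.
  by rewrite !mxE !eqxx eq_sym (negbTE o01) add0r mulr1.
have [[y Ty] par] := TP t; split=> [[u [/par pu u0]]|ft0].
  rewrite -o10 -dotprod_basis dotprodC.
  apply/(parallel_orthogonal _ (spointP u) pu).
  by rewrite dotprodC dotprod_basis.
exists y; split=> //; have [r ->] := par y Ty.
by rewrite mxE o10 ft0 mulr0.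
Qed.

Lemma exists_third i j : exists m : 'I_d.+1, (m != i) && (m != j).
Proof.
have [/hasP[m _ mij]|/hasPn ij] := boolP (has (fun m => (m != i) && (m != j)) [:: o0; o1; o2]).
  by exists m.
have /(uniq_leq_size o_uniq)// : {subset [:: o0; o1; o2] <= [:: i; j]}.
by move=> m /ij; rewrite negb_and !negbK !inE.
Qed.

(** A direction e_i + f e_j can be moved to e_i + f e_m or to e_m + f e_j for any
    third index m; with at least three indices this reaches every ordered pair. *)
Lemma computable_vec2 f k l : computable f -> k != l -> traceable (fun t => vec2 k l (f t)).
Proof.
move=> cf.
have shift i j m : i != j -> m != i -> m != j -> traceable (fun t => vec2 i j (f t)) ->
    traceable (fun t => vec2 i m (f t)).
  move=> ij mi mj; apply: traceable_shift.
  by rewrite /= !inE negb_or ij (eq_sym i) mi (eq_sym j) mj.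
have repl i j m : i != j -> m != i -> m != j -> traceable (fun t => vec2 i j (f t)) ->
    traceable (fun t => vec2 m j (f t)).
  move=> ij mi mj; apply: traceable_replace.
  by rewrite /= !inE negb_or mi mj (eq_sym j) ij.
have from_o0 j : j != o0 -> traceable (fun t => vec2 o0 j (f t)).
  move=> j0; have [->//|j1] := eqVneq j o1.
  by apply: (shift o0 o1 j) => //; exact: o01.
have to_nonzero i j : i != o0 -> j != o0 -> i != j -> traceable (fun t => vec2 i j (f t)).
  move=> i0 j0 ij; apply: (repl o0) => //; first by rewrite eq_sym.
  exact: from_o0.
have [->|k0] := eqVneq k o0; first by rewrite eq_sym; exact: from_o0.
have [->|l0] := eqVneq l o0; last exact: to_nonzero.
have [m /andP[m0 mk]] := exists_third o0 k.
move=> k0'; apply: (shift k m) => //; rewrite 1?eq_sym//.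
by apply: to_nonzero => //; rewrite eq_sym.
Qed.

End Directions.

(** * Coordinates of a point *)

Section Coordinates.
Variables (R : realType) (d : nat).
Hypothesis d_ge2 : (2 <= d)%N.
Notation S := (spoint R d).
Notation basis j := (delta_mx 0 j : 'rV[R]_d.+1).
Variables (o0 o1 o2 : 'I_d.+1).
Hypothesis o_uniq : uniq [:: o0; o1; o2].
Notation encode := (@encode R d o0 o1 o2 o_uniq).

Lemma coord_neq0 (p : S) : exists j, (val p) 0 j != 0.
Proof.
apply: contrapT => /forallNP p0; have := spointP p; rewrite /sphere /= /dotprod big1.
  by move=> /eqP; rewrite eq_sym oner_eq0.
by move=> j _; have /negP/negPn/eqP -> := p0 j; rewrite mul0r.
Qed.

Lemma sphere_pos_scale (u v : 'rV[R]_d.+1) r : sphere u -> sphere v -> 0 < r ->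
  v = r *: u -> v = u.
Proof.
rewrite /sphere /= => u1 v1 r0 vE; move: v1.
rewrite vE dotprodZl dotprodZr u1 mulr1 -expr2 => /eqP.
by rewrite sqrp_eq1 ?ltW// => /eqP ->; rewrite scale1r.
Qed.

Lemma encodeE a : exists2 r, 0 < r & val (encode a) = r *: vec2 o0 o1 a.
Proof. by eexists; [exact: normalize_scale_gt0 (vec2_neq0 a (o01 o_uniq))|]. Qed.

(** The two half-spaces are x_0 + x_1 / C >= 0 and x_0 - x_1 / C >= 0; on the unit
    circle of the coordinates o0 and o1 they force x_0 > 0 and a slope between
    -C and C. *)
Definition number_point (C : R) (p : S) : Prop :=
  (forall j, (j != o0) && (j != o1) -> (val p) 0 j = 0) /\
  (0 <= dotprod (val p) (val (encode C^-1)) /\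
   0 <= dotprod (val p) (val (encode (- C^-1)))).

Lemma definable_number_point I (C : R) (a : (I -> S) -> S) : is_term a ->
  definable (fun x => number_point C (a x)).
Proof.
move=> ta; apply: definable_and.
  by apply: definable_forall => j; exact/definable_imply/definable_coord0.
by apply: definable_and; apply: definable_nonneg => //; exact: is_term_const.
Qed.

Lemma dotprod_encode (p : S) a :
  (0 <= dotprod (val p) (val (encode a))) = (0 <= (val p) 0 o0 + a * (val p) 0 o1).
Proof.
have [r r0 ->] := encodeE a.
by rewrite dotprodZr dotprodDr dotprodZr !dotprod_basis pmulr_rge0.
Qed.

Lemma number_pointP (C : R) (p : S) : 0 < C ->
  number_point C p <-> exists2 a, `|a| <= C & p = encode a.
Proof.
move=> C0; rewrite /number_point !dotprod_encode.
have n01 := o01 o_uniq.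
split=> [[pf [pC pNC]]|[a aC ->]]; last first.
  have [r r0 ->] := encodeE a; split=> [j /andP[/negbTE j0 /negbTE j1]|].
    by rewrite !mxE j0 j1 !andbF mulr0 addr0 mulr0.
  rewrite !mxE !eqxx (negbTE n01) eq_sym (negbTE n01) !mulr0 !addr0 !add0r !mulr1.
  have -> b : r + b * (r * a) = r * (1 + b * a) by ring.
  have -> b : r + b * (r * a) = r * (1 + b * a) by ring.
  rewrite !pmulr_rge0// mulNr.
  have : `|C^-1 * a| <= 1.
    by rewrite normrM gtr0_norm ?invr_gt0// ler_pdivrMl// mulr1.
  by rewrite ler_norml => /andP[? ?]; split; lra.
set p0 := (val p) 0 o0 in pC pNC *; set p1 := (val p) 0 o1 in pC pNC *.
have pE : val p = p0 *: basis o0 + p1 *: basis o1.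
  apply/rowP => j; rewrite !mxE eqxx /=.
  have [->|j0] := eqVneq j o0; first by rewrite (negbTE n01) mulr0 addr0 mulr1.
  have [->|j1] := eqVneq j o1; first by rewrite mulr0 add0r mulr1.
  by rewrite pf ?j0// !mulr0 addr0.
have p0_ge0 : 0 <= p0 by rewrite mulNr in pNC; lra.
have p0_gt0 : 0 < p0.
  rewrite lt0r p0_ge0 andbT; apply/eqP => p00.
  have p10 : p1 = 0.
    rewrite p00 !add0r mulNr oppr_ge0 in pC pNC.
    have /eqP : C^-1 * p1 == 0 by rewrite eq_le pC pNC.
    by move=> /eqP; rewrite mulf_eq0 invr_eq0 (gt_eqF C0) /= => /eqP.
  have [j] := coord_neq0 p; rewrite pE p00 p10 !scale0r addr0 mxE eqxx.
  by [].
exists (p1 / p0).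
  rewrite normrM normfV (gtr0_norm p0_gt0) ler_pdivrMr// ler_norml.
  have CpC x : C * (C^-1 * x) = x by rewrite mulrA mulfV ?mul1r ?gt_eqF.
  have := ler_wpM2l (ltW C0) pC; have := ler_wpM2l (ltW C0) pNC.
  rewrite !mulr0 !mulrDr mulNr mulrN !CpC => *.
  by apply/andP; split; lra.
apply: val_inj; have [r r0 aE] := encodeE (p1 / p0).
apply: (@sphere_pos_scale _ _ (p0 / r)); [exact: spointP|exact: spointP| |].
  exact: divr_gt0.
rewrite aE scalerA divfK ?gt_eqF// scalerDr scalerA pE mulrC divfK ?gt_eqF//.
Qed.

Definition on_point (Q : S -> ('I_d.+1 -> S) -> Prop) :=
  definable (fun z : unit + 'I_d.+1 -> S => Q (z (inl tt)) (z \o inr)).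

Lemma exists_orthogonal_pair (x1 x2 t1 t2 : R) : x1 * t2 = x2 * t1 ->
  exists a b, [/\ (a != 0) || (b != 0), a * x1 + b * x2 = 0 & a * t1 + b * t2 = 0].
Proof.
move=> xt.
have [x0|xN0] := boolP ((x1 == 0) && (x2 == 0)); last first.
  exists x2, (- x1); rewrite oppr_eq0 -negb_and andbC xN0; split=> //; first by ring.
  by rewrite -xt; ring.
case/andP: x0 => /eqP -> /eqP ->.
have [t0|tN0] := boolP ((t1 == 0) && (t2 == 0)); last first.
  exists t2, (- t1); rewrite oppr_eq0 -negb_and andbC tN0; split=> //; last by ring.
  by rewrite !mulr0 addr0.
case/andP: t0 => /eqP -> /eqP ->.
by exists 1, 0; rewrite oner_eq0 !mulr0 addr0.
Qed.

(** Vectors (x_j, x_k) and (t_j, t_k) of a plane are proportional when some unit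
    vector u of the plane is orthogonal to both.  On the side of t, u is asked to
    be orthogonal to e_m + t_j e_j + t_k e_k, which has the advantage over
    t_j e_j + t_k e_k that it never vanishes. *)
Lemma definable_proportional j k : j != k -> exists2 Q, on_point Q &
  forall (x : S) (t : 'I_d.+1 -> R),
    Q x (encode \o t) <-> (val x) 0 j * t k = (val x) 0 k * t j.
Proof.
move=> jk; have [m /andP[mj mk]] := exists_third o_uniq j k.
have mjk : uniq [:: m; j; k] by rewrite /= !inE negb_or mj mk jk.
have var i : computable o_uniq (fun t : 'I_d.+1 -> R => t i).
  exact/polyfun_computable/polyfun_var.
have [T [dT TP]] := traceable_pair mjk (computable_vec2 (var j) mj) (computable_vec2 (var k) mk).
exists (fun (x : S) p => exists u : S, (in_frame m j k (val u) /\ (val u) 0 m = 0) /\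
   (dotprod (val x) (val u) = 0 /\ exists y : S, T p y /\ dotprod (val u) (val y) = 0)).
  apply: definable_exists1; apply: definable_and.
    apply: definable_and; first exact/definable_in_frame/is_term_var.
    exact/definable_coord0/is_term_var.
  apply: definable_and.
    apply: definable_orthogonal; last exact: is_term_var.
    exact: (@is_term_var R d (unit + 'I_d.+1 + unit)%type (inl (inl tt))).
  apply: definable_exists1; apply: definable_and.
    exact: (definable_subst (fun n => inl (inl (inr n))) (inr tt) dT).
  by apply: definable_orthogonal; exact: is_term_var.
move=> x t; have [[y0 Ty0] Tpar] := TP t.
split=> [[u [[uf um] [xu [y [Ty uy]]]]]|].
  move: uy => /(parallel_orthogonal _ (spointP y) (Tpar y Ty)).
  rewrite dotprod_vec3 um mulr0 add0r => ut.
  move: xu; rewrite {1}(in_frame_vec3 mjk uf) dotprod_vec3 um mul0r add0r => ux.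
  apply/eqP; rewrite -subr_eq0; apply/eqP.
  set D := _ - _.
  have uj0 : (val u) 0 j * D = 0.
    transitivity (((val u) 0 j * (val x) 0 j + (val u) 0 k * (val x) 0 k) * t k -
      (val x) 0 k * (t j * (val u) 0 j + t k * (val u) 0 k)); first by rewrite /D; ring.
    by rewrite ux ut mul0r mulr0 subr0.
  have uk0 : (val u) 0 k * D = 0.
    transitivity ((val x) 0 j * (t j * (val u) 0 j + t k * (val u) 0 k) -
      ((val u) 0 j * (val x) 0 j + (val u) 0 k * (val x) 0 k) * t j); first by rewrite /D; ring.
    by rewrite ux ut mul0r mulr0 subr0.
  apply/eqP; apply: contraT => DN0; have [i] := coord_neq0 u.
  have zero a : a * D = 0 -> a = 0.
    by move=> /eqP; rewrite mulf_eq0 (negbTE DN0) orbF => /eqP.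
  have [|if_] := boolP (i \in [:: m; j; k]); last by rewrite uf ?eqxx.
  by rewrite !inE => /or3P[]/eqP->; rewrite ?um ?(zero _ uj0) ?(zero _ uk0) eqxx.
move=> /exists_orthogonal_pair[a [b [ab0 abx abt]]].
have v0 : vec3 m j k 0 a b != 0 by apply: vec3_neq0 => //; rewrite eqxx /= -negb_and in ab0 *.
pose u : S := spoint_of (sphere_normalize v0).
have [r uE] := parallel_normalize (vec3 m j k 0 a b).
have uE' : val u = vec3 m j k 0 (r * a) (r * b) by rewrite /= uE scale_vec3 mulr0.
have [um _ _ uf] := vec3_coords 0 (r * a) (r * b) mjk.
exists u; rewrite uE'; split=> //; split.
  rewrite dotprod_vec3 mul0r add0r -!mulrA -mulrDr.
  by rewrite abx mulr0.
exists y0; split=> //; apply/(parallel_orthogonal _ (spointP y0) (Tpar y0 Ty0)).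
rewrite dotprod_vec3; have [-> -> -> _] := vec3_coords 0 (r * a) (r * b) mjk.
rewrite mulr0 add0r [t j * _]mulrC [t k * _]mulrC -!mulrA -mulrDr abt mulr0 //.
Qed.

(** The witness z is e_j or its opposite, and is in the same closed half-space as x
    and as y, the positive multiple of e_m + t_j e_j: so x_j and t_j both have
    the sign of z or vanish. *)
Lemma definable_same_sign j : exists2 Q, on_point Q &
  forall (x : S) (t : 'I_d.+1 -> R), Q x (encode \o t) <-> 0 <= (val x) 0 j * t j.
Proof.
have [m /andP[mj _]] := exists_third o_uniq j j.
have [k /andP[km kj]] := exists_third o_uniq m j.
have mjk : uniq [:: m; j; k] by rewrite /= !inE negb_or mj !(eq_sym _ k) km kj.
have var : computable o_uniq (fun t : 'I_d.+1 -> R => t j).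
  exact/polyfun_computable/polyfun_var.
have [[T [dT TP]] _] := traceable_swap mjk (computable_vec2 var mj).
exists (fun (x : S) p => exists y : S, (T p y /\ 0 <= dotprod (val y) (val (axis R m))) /\
  exists z : S, (forall i, i != j -> (val z) 0 i = 0) /\
    (0 <= dotprod (val x) (val z) /\ 0 <= dotprod (val y) (val z))).
  apply: definable_exists1; apply: definable_and.
    apply: definable_and.
      exact: (definable_subst (fun n => inl (inr n)) (inr tt) dT).
    by apply: definable_nonneg => //; [exact: is_term_var|exact: is_term_const].
  apply: definable_exists1; apply: definable_and.
    by apply: definable_forall => i; exact/definable_imply/definable_coord0/is_term_var.
  by apply: definable_and; apply: definable_nonneg => //; exact: is_term_var.
have dot_axis (v z : 'rV[R]_d.+1) : (forall i, i != j -> z 0 i = 0) ->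
    dotprod v z = v 0 j * z 0 j.
  by move=> z0; rewrite /dotprod (bigD1 j)//= big1 ?addr0// => i /z0 ->; rewrite mulr0.
move=> x t; split.
  move=> [y [[/TP[r yE] ym] [z [z0 []]]]]; rewrite !dot_axis// => xz yz.
  have rm : (val y) 0 m = r.
    by rewrite yE !mxE !eqxx (negbTE mj) mulr0 addr0 mulr1.
  have rj : (val y) 0 j = r * t j.
    by rewrite yE !mxE !eqxx eq_sym (negbTE mj) add0r mulr1.
  have r0 : 0 <= r by move: ym; rewrite dotprod_basis rm.
  have r_gt0 : 0 < r.
    rewrite lt0r r0 andbT; apply/eqP => rr0; have [i] := coord_neq0 y.
    by rewrite yE rr0 scale0r mxE eqxx.
  have zj : 0 < (val z) 0 j ^+ 2.
    rewrite exprn_even_gt0//=; have [i] := coord_neq0 z.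
    by have [->//|/z0->] := eqVneq i j; rewrite eqxx.
  rewrite -(pmulr_rge0 _ zj) -(pmulr_rge0 _ r_gt0).
  have -> : r * ((val z) 0 j ^+ 2 * ((val x) 0 j * t j)) =
            ((val x) 0 j * (val z) 0 j) * ((r * t j) * (val z) 0 j) by ring.
  by rewrite mulr_ge0// -rj.
move=> xt; have v0 := vec2_neq0 (t j) mj.
have r0 := normalize_scale_gt0 v0.
pose y : S := spoint_of (sphere_normalize v0).
set r := (Num.sqrt _)^-1 in r0.
have yE : val y = r *: vec2 m j (t j) by [].
exists y; split; first split.
- by apply/TP; exists r.
- by rewrite dotprod_basis yE !mxE !eqxx (negbTE mj) mulr0 addr0 mulr1 ltW.
have [e [eS ex et]] : exists e : R, [/\ e ^+ 2 = 1, 0 <= (val x) 0 j * e & 0 <= t j * e].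
  have [x0|x0|x0] := ltgtP ((val x) 0 j) 0.
  - exists (-1); rewrite sqrrN expr1n !mulrN1 !oppr_ge0; split=> //; first exact: ltW.
    by move: xt; rewrite nmulr_rge0.
  - exists 1; rewrite expr1n !mulr1; split=> //; first exact: ltW.
    by move: xt; rewrite pmulr_rge0.
  - have [t0|/ltW t0] := leP 0 (t j).
      by exists 1; rewrite expr1n !mulr1 t0 x0.
    by exists (-1); rewrite sqrrN expr1n !mulrN1 !oppr_ge0 t0 x0 lexx.
have zS : sphere (e *: basis j).
  by rewrite /sphere /= dotprodZl dotprodZr dotprod_basis mxE !eqxx mulr1 -expr2.
have z0 i : i != j -> (e *: basis j) 0 i = 0.
  by move=> /negbTE ij; rewrite !mxE ij andbF mulr0.
have zj : (e *: basis j) 0 j = e by rewrite !mxE !eqxx mulr1.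
exists (spoint_of zS); split=> //.
rewrite ![val (spoint_of zS)]/= !dot_axis// zj yE !mxE !eqxx eq_sym (negbTE mj) add0r mulr1.
by split=> //; rewrite -mulrA pmulr_rge0.
Qed.

(** If t is proportional to x and both have norm 1, then x = s t with
    s = <x, t> = 1 or -1, and equal signs of the coordinates give s >= 0. *)
Lemma definable_coordinates : exists2 Q, on_point Q &
  forall (x : S) (t : 'I_d.+1 -> R),
    Q x (encode \o t) <-> forall j, (val x) 0 j = t j.
Proof.
pose f (t : 'I_d.+1 -> R) := \sum_j t j ^+ 2 + -1.
have pf : polyfun f.
  apply: polyfun_add; last exact: polyfun_cst.
  by apply: polyfun_sum => j _; exact/polyfun_exp/polyfun_var.
have [Z dZ ZP] := polyfun_zero_definable o_uniq pf.
have /boolp.choice[Q QP] : forall jk : 'I_d.+1 * 'I_d.+1, exists Q, on_point Q /\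
    forall (x : S) (t : 'I_d.+1 -> R), Q x (encode \o t) <->
      (val x) 0 jk.1 * t jk.2 = (val x) 0 jk.2 * t jk.1.
  move=> [j k]; have [->|jk] := eqVneq j k.
    by exists (fun _ _ => True); split=> [|x t]; [exact: definable_true|].
  by have [Q] := definable_proportional jk; exists Q.
have /boolp.choice[P PP] : forall j, exists P, on_point P /\
    forall (x : S) (t : 'I_d.+1 -> R), P x (encode \o t) <-> 0 <= (val x) 0 j * t j.
  by move=> j; have [P] := definable_same_sign j; exists P.
exists (fun x p => Z p /\ ((forall jk, Q jk x p) /\ forall j, P j x p)).
  apply: definable_and; first exact: (definable_comp inr dZ).
  by apply: definable_and; apply: definable_forall => l; [have [] := QP l|have [] := PP l].
move=> x t; have x1 : \sum_j (val x) 0 j ^+ 2 = 1.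
  by rewrite -[RHS](spointP x); apply: eq_bigr => j _; rewrite expr2.
split=> [[/ZP ft [Qx Px]]|xt]; last first.
  split; first by apply/ZP; rewrite /f; under eq_bigr do rewrite -xt; rewrite x1 subrr.
  split=> [jk|j]; first by apply/(QP jk).2; rewrite -!xt mulrC.
  by apply/(PP j).2; rewrite -xt -expr2 sqr_ge0.
have t1 : \sum_j t j ^+ 2 = 1 by move: ft => /eqP; rewrite subr_eq0 => /eqP.
pose s := \sum_j (val x) 0 j * t j.
have xs k : (val x) 0 k = s * t k.
  transitivity ((val x) 0 k * \sum_j t j ^+ 2); first by rewrite t1 mulr1.
  rewrite mulr_sumr mulr_suml; apply: eq_bigr => j _.
  have /(QP (j, k)).2 /= jk := Qx (j, k).
  by rewrite expr2 mulrA -jk mulrAC.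
have s1 : s = 1.
  have s0 : 0 <= s by apply: sumr_ge0 => j _; apply/(PP j).2; exact: Px.
  have : \sum_j (val x) 0 j ^+ 2 = s ^+ 2 * \sum_j t j ^+ 2.
    by rewrite mulr_sumr; apply: eq_bigr => j _; rewrite xs exprMn.
  by rewrite x1 t1 mulr1 => /esym/eqP; rewrite sqrp_eq1// => /eqP.
by move=> j; rewrite xs s1 mul1r.
Qed.

End Coordinates.

(** * The universality theorem *)

Lemma semialgebraic_is_projection (R : realType) n d (A : set 'M[R]_(n, d.+1)) :
  semialgebraic (mxvec @` A) ->
  algebraic_projection (fun x : 'I_n * 'I_d.+1 -> R => A (\matrix_(i, j) x (i, j))).
Proof.
move=> [r [B [[m [f BE]] AE]]].
have [g gK Kg] := curry_mxvec_bij n d.+1.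
pose z (u : ('I_n * 'I_d.+1) + 'I_r -> R) (s : 'I_(n * d.+1 + r)) : R :=
  match fintype.split s with inl a => u (inl (g a)) | inr b => u (inr b) end.
exists 'I_r, 'I_m, (fun k u => mpoly.meval (z u) (f k)); split=> [k|x].
  apply: (polyfun_comp (polyfun_meval (f k))) => s; rewrite /z.
  by case: (fintype.split s) => [a|b]; exact: polyfun_var.
set X := \matrix_(i, j) _.
have zE y : z (joint x y) = (row_mx (mxvec X) (\row_b y b)) 0.
  apply/funext => s; rewrite /z mxE; case: (fintype.split s) => [a|b]; last by rewrite mxE.
  rewrite /= -{2}(Kg a isT); case: (g a) => i j.
  by rewrite mxvecE mxE.
have -> : A X <-> (lsubmx @` B) (mxvec X).
  rewrite -AE; split=> [AX|[Y AY /(can_inj mxvecK) <-]//]; by exists X.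
split=> [[b Bb bX]|[y yP]].
  exists (fun j => rsubmx b 0 j) => k; rewrite zE.
  rewrite (_ : \row_j rsubmx b 0 j = rsubmx b); last by apply/rowP => j; rewrite mxE.
  by rewrite -bX hsubmxK; move: Bb; rewrite BE; exact.
exists (row_mx (mxvec X) (\row_b y b)); last by rewrite row_mxKl.
by rewrite BE => k /=; rewrite -zE.
Qed.

Theorem theorem1p9 (R : realType) (d n : nat) (hd : (2 <= d)%N) (hn : (1 <= n)%N)
    (A : set 'M[R]_(n, d.+1)) (Acompact : compact A)
    (Asemialg : semialgebraic_sphere_pow A) :
  exists (L : linkage R d) (W : {set vertex L})
         (w : 'I_n -> {v : vertex L | v \in W}),
    bijective w /\ [set \matrix_(i < n) psi (w i) | psi in conf L W] = A.
Proof.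
have [Asphere Asa] := Asemialg.
pose co (X : 'M[R]_(n, d.+1)) (ij : 'I_n * 'I_d.+1) := X ij.1 ij.2.
have coK x : co (\matrix_(i, j) x (i, j)) = x by apply/funext => -[i j]; rewrite /co mxE.
have Kco X : \matrix_(i, j) co X (i, j) = X by apply/matrixP => i j; rewrite mxE.
have co_cont ij : continuous (co^~ ij) by exact: coord_continuous.
have [||X AX [i j]|U [K [F [C [C1 pF AF]]]]] := @compact_semialgebraic_bounded_equations
    R _ _ co co_cont _ A _ Acompact _ (semialgebraic_is_projection Asa) 1.
- by move=> x; exists (\matrix_(i, j) x (i, j)); rewrite coK.
- by move=> X; rewrite Kco.
- by have := sphere_coord_le1 j (Asphere X AX i); rewrite mxE.
have C0 : 0 < C by exact: lt_le_trans C1.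
have o_uniq : uniq [:: inord 0; inord 1; inord 2 : 'I_d.+1].
  by rewrite /= !inE -!val_eqE /= !inordK// ltnS (ltnW hd).
pose N := ('I_n * 'I_d.+1 + U)%type.
pose enc := @encode R d _ _ _ o_uniq.
have [Q dQ QP] := definable_coordinates R hd o_uniq.
have /boolp.choice[Z ZP] : forall k, exists Z : (N -> spoint R d) -> Prop,
    definable Z /\ forall t, Z (enc \o t) <-> F k t = 0.
  by move=> k; have [Z] := polyfun_zero_definable o_uniq (pF k); exists Z.
(* the numbers p consist of the coordinates of the points and of the unknowns u *)
pose P (x : 'I_n -> spoint R d) := exists p : N -> spoint R d,
  (forall n, number_point o_uniq C (p n)) /\
  ((forall i, Q (x i) (fun j => p (inl (i, j)))) /\ forall k, Z k p).
have dP : definable P.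
  apply: definable_exists; apply: definable_and.
    by apply: definable_forall => s; exact/definable_number_point/is_term_var.
  apply: definable_and; apply: definable_forall => l; last first.
    by have [dZ _] := ZP l; exact: (definable_comp inr dZ).
  exact: (definable_comp (joint (fun=> inl l) (fun j => inr (inl (l, j)))) dQ).
have PA x : P x <-> A (\matrix_(i < n) val (x i)).
  set X := \matrix_i _; have XE i j : X i j = (val (x i)) 0 j by rewrite mxE.
  split=> [[p [pn [px pZ]]]|AX].
    have /boolp.choice[t tp] : forall s, exists a, `|a| <= C /\ p s = enc a.
      by move=> s; have [a] := (number_pointP o_uniq (p s) C0).1 (pn s); exists a.
    have pE : p = enc \o t by apply/funext => s; have [] := tp s.
    apply/AF; exists (t \o inr) => [u|k]; first by have [] := tp (inr u).
    rewrite (_ : joint _ _ = t); first by apply/(ZP k).2; rewrite -pE.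
    apply/funext => -[[i j]|//] /=; rewrite /co /= XE.
    by move: (px i); rewrite pE => /(QP (x i) (fun j => t (inl (i, j))))/(_ j).
  have /AF[u uC uF] := AX; pose t : N -> R := joint (co X) u.
  exists (enc \o t); split=> [s|]; last split=> [i|k].
  - apply/(number_pointP _ _ C0); exists (t s) => //; case: s => [[i j]|] //=.
    apply: le_trans C1; rewrite /co /= XE.
    exact/sphere_coord_le1/spointP.
  - by apply/(QP (x i) (fun j => t (inl (i, j)))) => j; rewrite -XE.
  - exact/(ZP k).2.
have [L [W [w [wbij LE]]]] := definable_linkage hd dP.
exists L, W, w; split=> //; rewrite LE; apply/seteqP; split=> X /=.
  by move=> [x /PA Ax <-].
move=> AX.
have XS i : sphere (row i X) by exact: Asphere.
have XE : \matrix_(i < n) val (spoint_of (XS i)) = X.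
  by apply/row_matrixP => i; rewrite rowK.
by exists (fun i => spoint_of (XS i)) => //; apply/PA; rewrite XE.
Qed.
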